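(* Let $G=G_1\cup\dots\cup G_k$ and $H=H_1\cup\dots\cup H_\ell$ be finite simple graphs, where $G_1,\dots,G_k$ are the connected components of $G$, $H_1,\dots,H_\ell$ are the connected components of $H$, and $k\le \ell$. If at least one of the following three conditions holds, then $q(G\vee H)\ne 2$ (equivalently, $S(G\vee H)$ contains no orthogonal symmetric matrix): (a) $|G|<\ell$; (b) $\mathrm{iso}(G)\ne \emptyset$ and $k+\ell>|G|+|\mathrm{iso}(G)|$; (c) $\mathrm{iso}(G)=\emptyset$, $\mathrm{iso}(H)\ne \emptyset$, $k<\ell<2k$, $|H|<2k$ and $|G|<k+\ell$. Moreover, if all the connected components of $G$ and of $H$ are complete graphs, then $q(G\vee H)=2$ if none of (a), (b), (c) holds, and $q(G\vee H)=3$ if at least one of (a), (b), (c) holds.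
   Context: All graphs are simple, undirected, with nonempty finite vertex sets. $|G|$ is the number of vertices of $G$ and $\mathrm{iso}(G)$ is the set of isolated (degree zero) vertices of $G$. The join $G\vee H$ is the disjoint union of $G$ and $H$ together with all edges joining a vertex of $G$ to a vertex of $H$. For a graph $G$ with vertex set $\{1,\dots,n\}$, $S(G)$ is the set of real symmetric $n\times n$ matrices $A=(a_{ij})$ such that for $i\ne j$, $a_{ij}\neq 0$ if and only if $\{i,j\}$ is an edge of $G$ (diagonal entries unrestricted). $q(G)$ is the minimum, over $A\in S(G)$, of the number of distinct eigenvalues of $A$. *)

(* Defs.v *)
From HB Require Import structures.
From mathcomp Require Import all_boot all_order all_algebra.
From mathcomp Require Import finmap.
From mathcomp Require Import all_classical reals.

Set Implicit Arguments.
Unset Strict Implicit.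
Unset Printing Implicit Defensive.

Import Order.TTheory GRing.Theory Num.Theory.

Local Open Scope ring_scope.

Record sgraph (n : nat) := SGraph {
  edge :> rel 'I_n;
  edge_sym : symmetric edge;
  edge_irr : irreflexive edge
}.

(* The vertices of G are the first m elements of 'I_(m + n), those of H the
   last n. *)
Definition join_edge m n (G : sgraph m) (H : sgraph n) : rel 'I_(m + n) :=
  fun x y => match fintype.split x, fintype.split y with
             | inl i, inl j => G i j
             | inr i, inr j => H i j
             | _, _ => true
             end.

Lemma join_edge_sym m n (G : sgraph m) (H : sgraph n) :
  symmetric (join_edge G H).
Proof.
move=> x y; rewrite /join_edge.
by case: (fintype.split x) => i; case: (fintype.split y) => j //; apply: edge_sym.
Qed.

Lemma join_edge_irr m n (G : sgraph m) (H : sgraph n) :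
  irreflexive (join_edge G H).
Proof. by move=> x; rewrite /join_edge; case: (fintype.split x) => i; apply: edge_irr. Qed.

Definition join m n (G : sgraph m) (H : sgraph n) : sgraph (m + n) :=
  SGraph (@join_edge_sym m n G H) (@join_edge_irr m n G H).

Definition iso n (G : sgraph n) : {set 'I_n} :=
  [set v : 'I_n | [forall u, ~~ G v u]].

Definition components n (G : sgraph n) : {set {set 'I_n}} :=
  equivalence_partition (connect G) [set: 'I_n].

Definition complete_on n (G : sgraph n) (C : {set 'I_n}) : bool :=
  [forall u in C, forall v in C, (u != v) ==> G u v].

Definition complete_components n (G : sgraph n) : bool :=
  [forall C in components G, complete_on G C].

Definition symmat (R : realType) n (G : sgraph n) : set 'M[R]_n :=
  [set A | A^T = A /\ forall i j, i != j -> (A i j != 0) = G i j]%classic.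

Definition eigenvalues (R : realType) n (A : 'M[R]_n) : set R :=
  [set a | eigenvalue A a]%classic.

Lemma eigenvalues_finite (R : realType) n (A : 'M[R]_n) :
  finite_set (eigenvalues A).
Proof.
have p0 : char_poly A != 0 by rewrite monic_neq0 ?char_poly_monic.
have [rs rs_roots] : exists rs : seq R, forall a, root (char_poly A) a -> a \in rs.
  move: (char_poly A) p0 => p; have [k] := ubnP (size p).
  elim: k p => // k IH p pk p0.
  have [[a ra]|nora] := pselect (exists a, root p a); last first.
    by exists [::] => a ra; case: nora; exists a.
  have /factor_theorem [r pr] := ra.
  have r0 : r != 0 by apply: contraNneq p0 => r0; rewrite pr r0 mul0r.
  have szr : (size r < k)%N by move: pk; rewrite pr size_Mmonic ?monicXsubC // size_XsubC addn2.
  have [rs rsP] := IH _ szr r0.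
  exists (a :: rs) => b; rewrite pr rootM root_XsubC inE => /orP[/rsP ->|->] //.
  by rewrite orbT.
apply: (@sub_finite_set _ _ [set` rs]); last exact: finite_seq.
by move=> a; rewrite /eigenvalues /= eigenvalue_root_char => /rs_roots.
Qed.

(* fset_set is the actual set of eigenvalues, by eigenvalues_finite. *)
Definition num_eigenvalues (R : realType) n (A : 'M[R]_n) : nat :=
  #|` fset_set (eigenvalues A)|.

Definition attained (R : realType) n (G : sgraph n) (k : nat) : bool :=
  `[< exists2 A : 'M[R]_n, symmat G A & num_eigenvalues A = k >].

Lemma attained_ex (R : realType) n (G : sgraph n) : exists k, attained R G k.
Proof.
pose A : 'M[R]_n := \matrix_(i, j) (G i j)%:R.
exists (num_eigenvalues A); apply/asboolP; exists A => //; split.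
  by apply/matrixP => i j; rewrite !mxE edge_sym.
by move=> i j _; rewrite mxE; case: (G i j); rewrite ?oner_eq0 ?eqxx.
Qed.

Definition q (R : realType) n (G : sgraph n) : nat := ex_minn (attained_ex R G).

Definition condA m n (G : sgraph m) (H : sgraph n) : bool :=
  (m < #|components H|)%N.

Definition condB m n (G : sgraph m) (H : sgraph n) : bool :=
  (iso G != finset.set0) && (m + #|iso G| < #|components G| + #|components H|)%N.

Definition condC m n (G : sgraph m) (H : sgraph n) : bool :=
  [&& iso G == finset.set0, iso H != finset.set0,
      (#|components G| < #|components H| < 2 * #|components G|)%N,
      (n < 2 * #|components G|)%N
    & (m < #|components G| + #|components H|)%N].

(* Main.v *)
(* An orthogonal matrix of the join has blocks X in S(G), Y in S(H) and a nowhere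
   zero B with B B^T = I - X^2, B^T B = I - Y^2 and X B = - B Y, where X and Y are
   block diagonal along the components. Obstructions come from restricting
   suitable rows of B to the components: this gives mutually orthogonal nonzero
   vectors, which are too many for the space, or for the eigenspace of X, in
   which they live. An isolated vertex provides an eigenvector of the opposite
   side, hence the particular role of iso in (b) and (c).

   Conversely, when all components are complete, any two vertices of a component
   are twins, so conjugating by generic reflections acting inside the components
   turns every block that is not identically zero (not scalar, for a diagonal
   block) into a nowhere zero one. It therefore suffices to have X and Y diagonal,
   i.e. to colour the vertices by eigenvalues so that the colour classes in G and
   H match, any two components of G and H share a coupled colour and no component
   of size at least 2 is monochromatic. One or two coupled colours suffice outside
   (a), (b), (c); coupling by an all-ones block instead always gives A^3 = s^2 A,
   whence q <= 3. *)
Require Import Defs.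
From HB Require Import structures.
From mathcomp Require Import all_boot all_order all_algebra.
From mathcomp Require Import finmap.
From mathcomp Require Import all_classical reals.
From mathcomp Require Import spectral sesquilinear complex ring lra zify.

Set Implicit Arguments.
Unset Strict Implicit.
Unset Printing Implicit Defensive.

Import Order.TTheory GRing.Theory Num.Theory.

Local Open Scope ring_scope.

(** * Components *)

(** A component is handled through one chosen vertex, so that lying in the same component is an
    equality of representatives and counting [components] amounts to counting [reps]. *)
Definition rep n (G : sgraph n) : 'I_n -> 'I_n := fingraph.root G.

Definition reps n (G : sgraph n) : {set 'I_n} := [set x | rep G x == x].

Lemma connect_sgraph_sym n (G : sgraph n) : connect_sym G.
Proof. exact/sym_connect_sym/edge_sym. Qed.

Lemma rep_rep n (G : sgraph n) x : rep G (rep G x) = rep G x.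
Proof. exact: (root_root (@connect_sgraph_sym n G)). Qed.

Lemma rep_in_reps n (G : sgraph n) x : rep G x \in reps G.
Proof. by rewrite finset.inE rep_rep. Qed.

Lemma reps_rep n (G : sgraph n) x : x \in reps G -> rep G x = x.
Proof. by rewrite finset.inE => /eqP. Qed.

Lemma rep_connect n (G : sgraph n) x y : (rep G x == rep G y) = connect G x y.
Proof. exact: (root_connect (@connect_sgraph_sym n G)). Qed.

Lemma edge_rep n (G : sgraph n) x y : G x y -> rep G x = rep G y.
Proof. by move=> Gxy; apply/eqP; rewrite rep_connect connect1. Qed.

Lemma card_components n (G : sgraph n) : #|components G| = #|reps G|.
Proof.
pose P (x : 'I_n) := [set y in [set: 'I_n] | connect G x y].
have -> : components G = P @: reps G.
  rewrite /components /equivalence_partition; apply/eqP.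
  rewrite finset.eqEsubset; apply/andP; split; apply/fintype.subsetP => _ /imsetP[x xR ->].
    apply/imsetP; exists (rep G x); first exact: rep_in_reps.
    by apply/finset.setP => y; rewrite !finset.inE -!rep_connect rep_rep.
  by apply: imset_f; rewrite finset.inE.
rewrite card_in_imset // => x y xR yR /finset.setP /(_ y).
rewrite !finset.inE connect0 -rep_connect => /eqP.
by rewrite !reps_rep.
Qed.

Lemma complete_componentsE n (G : sgraph n) :
  complete_components G -> forall x y, rep G x = rep G y -> x != y -> G x y.
Proof.
move=> /forallP cG x y /eqP; rewrite rep_connect => xy xNy.
have /implyP := cG [set z in [set: 'I_n] | connect G x z].
rewrite imset_f ?finset.inE // => /(_ isT) /forallP /(_ x).
rewrite !finset.inE connect0 => /forallP /(_ y).
by rewrite !finset.inE xy xNy.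
Qed.

Lemma iso_rep n (G : sgraph n) x y : x \in iso G -> rep G y = rep G x -> y = x.
Proof.
rewrite finset.inE => /forallP xI /esym/eqP; rewrite rep_connect => /connectP[p].
by case: p => [|z p] //= /andP[Gxz]; move: (xI z); rewrite Gxz.
Qed.

Lemma iso_reps n (G : sgraph n) : iso G \subset reps G.
Proof.
apply/fintype.subsetP => x xI; rewrite finset.inE.
by rewrite (@iso_rep _ G x (rep G x)) // rep_rep.
Qed.

Lemma card_noniso n (G : sgraph n) :
  #|reps G :\: iso G| = (#|components G| - #|iso G|)%N.
Proof. by rewrite cardsD (finset.setIidPr (iso_reps G)) card_components. Qed.

Lemma noniso_edge n (G : sgraph n) x : x \notin iso G -> exists y, G x y.
Proof.
rewrite finset.inE negb_forall => /existsP[y]; rewrite negbK => Gxy.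
by exists y.
Qed.

(** A non-isolated representative has a neighbour, which lies in its component and is not a
    representative; [rep] recovers the representative, so the choice is injective. The set [E] can
    later be left uncoloured, or receive a second colour, without touching [reps]. *)
Lemma second_vertices n (G : sgraph n) :
  exists2 E : {set 'I_n}, [disjoint reps G & E] &
    #|E| = #|reps G :\: iso G| /\
    forall x, x \in reps G :\: iso G -> exists2 y, y \in E & rep G y = x /\ x != y.
Proof.
pose f x := odflt x [pick y | G x y].
have fP x : x \in reps G :\: iso G -> [/\ G x (f x), rep G (f x) = x & x != f x].
  move=> xR; have Gxf : G x (f x).
    rewrite /f; case: pickP => //= N; move: xR; rewrite finset.inE => /andP[/noniso_edge[y]].
    by rewrite N.
  move: xR; rewrite finset.inE => /andP[_ xR]; split => //.
    by rewrite -(edge_rep Gxf) reps_rep.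
  by apply/eqP => xf; move: Gxf; rewrite -xf edge_irr.
exists (f @: (reps G :\: iso G)); last split.
- rewrite disjoint_sym; apply/pred0P => y /=; apply/negP => /andP[/imsetP[x xR ->] fR].
  by case: (fP x xR) => _; rewrite (reps_rep fR) => ->; rewrite eqxx.
- rewrite card_in_imset // => x y xR yR fxy.
  by case: (fP x xR) => _ <- _; rewrite fxy; case: (fP y yR).
- move=> x xR; exists (f x); first exact: imset_f.
  by case: (fP x xR).
Qed.

Lemma nonrep_exists n (G : sgraph n) x y : x != y -> rep G x = rep G y ->
  exists u, rep G u = rep G x /\ u \notin reps G.
Proof.
move=> xy rxy; have [xR|xR] := boolP (x \in reps G); last by exists x.
exists y; split=> //; apply: contra xy => yR.
by rewrite -(reps_rep xR) -(reps_rep yR) rxy.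
Qed.

Lemma nontrivial_rep n (G : sgraph n) x y : x != y -> rep G x = rep G y ->
  rep G x \in reps G :\: iso G.
Proof.
move=> xy rxy; rewrite finset.inE rep_in_reps andbT; apply: contra xy => xI.
by rewrite (@iso_rep _ G _ x xI) ?rep_rep // (@iso_rep _ G _ y xI) ?rep_rep.
Qed.

(** * Selecting subsets of prescribed size *)

Lemma subset_card_between (T : finType) (A B : {set T}) c :
  A \subset B -> (#|A| <= c <= #|B|)%N ->
  exists S : {set T}, [/\ A \subset S, S \subset B & #|S| = c].
Proof.
move=> AB /andP[]; elim: c => [|c IH].
  rewrite leqn0 => A0 _; exists A; split => //; exact/eqP.
rewrite leq_eqVlt => /orP[/eqP Ac _|]; first by exists A.
rewrite ltnS => Ac cB; have [S [AS SB Sc]] := IH Ac (ltnW cB).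
have /fintype.subsetPn[x xB xS] : ~~ (B \subset S).
  by apply: contraTN cB => /subset_leq_card; rewrite Sc -ltnNge ltnS.
exists (x |: S); split; first exact: fintype.subset_trans AS (finset.subsetUr _ _).
  by rewrite finset.subUset SB finset.sub1set xB.
by rewrite cardsU1 xS Sc.
Qed.

(** Pairs inside a common fibre are removed one after another, one member going to [U] and the other
    staying out; once [f] is injective on the rest, any half will do. This yields two colours of
    balanced sizes such that every component of [H] met at least twice sees both. *)
Lemma split_fibers (I J : finType) (f : I -> J) (T : {set I}) :
  exists2 U : {set I}, U \subset T & #|U| = #|T|./2 /\
    forall x y, x \in T -> y \in T -> x != y -> f x = f y ->
      exists u v, [/\ u \in U, v \in T :\: U, f u = f x & f v = f x].
Proof.
have [k] := ubnP #|T|; elim: k T => // k IH T Tk.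
have [/existsP[x /existsP[y /and4P[xT yT xy /eqP fxy]]]|] :=
  boolP [exists x, exists y, [&& x \in T, y \in T, x != y & f x == f y]]; last first.
  move=> N; have [U [_ UT Uc]] : exists U : {set I},
      [/\ finset.set0 \subset U, U \subset T & #|U| = #|T|./2].
    apply: subset_card_between; first exact: finset.sub0set.
    by rewrite finset.cards0 /= -divn2 leq_div.
  exists U => //; split=> // x y xT yT xy fxy; case/existsP: N.
  by exists x; apply/existsP; exists y; rewrite xT yT xy fxy eqxx.
have yTx : y \in T :\ x by rewrite !finset.inE eq_sym xy.
have Tc : #|T| = #|T :\ x :\ y|.+2 by rewrite (cardsD1 x T) xT (cardsD1 y (T :\ x)) yTx.
have [|U UT [Uc UP]] := IH (T :\ x :\ y); first by move: Tk; rewrite Tc ltnS; apply: ltnW.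
have xU : x \notin U by apply/negP => /(fintype.subsetP UT); rewrite !finset.inE eqxx andbF.
have yU : y \notin U by apply/negP => /(fintype.subsetP UT); rewrite !finset.inE eqxx.
have UT' : U \subset T.
  by apply: fintype.subset_trans UT _; rewrite !finset.subDset !finset.subsetU ?fintype.subxx ?orbT.
exists (x |: U); first by rewrite finset.subUset finset.sub1set xT.
split; first by rewrite cardsU1 xU Uc Tc.
move=> a b aT bT ab fab.
(* The fibre of [x] and [y] is served by this very pair; every other fibre is unaffected by their
   removal, so the induction hypothesis serves it. *)
have [fa|fa] := eqVneq (f a) (f x).
  exists x, y; rewrite !finset.inE eqxx [y == x]eq_sym (negPf xy) (negPf yU) yT fa.
  by split.
have D c : f c = f a -> (c != x) && (c != y).
  by move=> fc; apply/andP; split; apply: contraNneq fa => ?; rewrite -fc; subst c => //; rewrite fxy.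
have D2 c : f c = f a -> c \in T -> c \in T :\ x :\ y.
  by move=> /D /andP[cx cy] cT; rewrite !finset.inE cx cy.
have [u [v [uU vU fu fv]]] := UP a b (D2 _ erefl aT) (D2 _ (esym fab) bT) ab fab.
exists u, v; split=> //; first by rewrite !finset.inE uU orbT.
by move: vU; rewrite !finset.inE negb_or => /and4P[-> _ -> ->].
Qed.

(** * Symmetric matrices with few eigenvalues *)

(** The complexification of [A] is Hermitian, hence diagonalizable over [R[i]] with real
    eigenvalues; these descend to [R] because the characteristic polynomial has coefficients in
    [R]. *)
Lemma real_spectral (R : realType) n (A : 'M[R]_n) : A^T = A ->
  exists P : 'M[R[i]]_n, exists2 d : 'rV[R]_n, P \in unitmx &
    map_mx (real_complex R) A =
      invmx P *m diag_mx (map_mx (real_complex R) d) *m P /\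
    forall j, eigenvalue A (d 0 j).
Proof.
move=> Asym; pose AC := map_mx (real_complex R) A.
have AH : AC \is hermsymmx.
  apply: realsym_hermsym.
    by apply/is_hermitianmxP; rewrite expr0 scale1r map_mx_id //= /AC map_trmx Asym.
  by apply/mxOverP => i j; rewrite mxE; apply/complex_realP; exists (A i j).
have [P [D [Pu DR AD]]] : exists P : 'M[R[i]]_n, exists D : 'rV_n,
    [/\ P \in unitmx, D \is a realmx & AC = invmx P *m diag_mx D *m P].
  exists (spectralmx AC), (spectral_diag AC); split; first exact: spectral_unit.
    exact: hermitian_spectral_diag_real.
  exact/orthomx_spectralP/hermitian_normalmx.
pose d := map_mx (@complex.Re R) D.
have dE : map_mx (real_complex R) d = D.
  by apply/matrixP => i j; rewrite !mxE RRe_real //; apply: (mxOverP DR).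
exists P, d; [exact: Pu | split; first by rewrite dE; exact: AD].
move=> j; rewrite eigenvalue_root_char -(fmorph_root (real_complex R)).
rewrite map_char_poly -eigenvalue_root_char.
(* Row [j] of [P] is an eigenvector, nonzero because [P] is invertible. *)
apply/eigenvalueP; exists (delta_mx 0 j *m P).
  rewrite [map_mx _ A]AD -dE !mulmxA -[delta_mx 0 j *m P *m _]mulmxA mulmxV // mulmx1.
  by rewrite -[delta_mx 0 j *m diag_mx _]rowE row_diag_mx -scalemxAl mxE.
apply: contraTneq (Pu) => P0.
have : delta_mx 0 j = 0 :> 'rV[R[i]]_n.
  by rewrite -[LHS](mulmxK Pu) P0 mul0mx.
by move/matrixP/(_ 0 j)/eqP; rewrite !mxE !eqxx oner_eq0.
Qed.

Lemma map_real_complex_inj (R : realType) m n :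
  injective (map_mx (real_complex R) : 'M_(m, n) -> 'M_(m, n)).
Proof. exact: map_mx_inj. Qed.

Lemma sym_one_eigenvalue (R : realType) n (A : 'M[R]_n) a : A^T = A ->
  (forall x, eigenvalue A x -> x = a) -> A = a%:M.
Proof.
move=> /real_spectral[P [d Pu [Ad dP]]] Aa.
apply: (@map_real_complex_inj R); rewrite Ad map_scalar_mx.
have -> : d = const_mx a by apply/matrixP => i j; rewrite ord1 mxE (Aa _ (dP j)).
by rewrite map_const_mx diag_const_mx -mulmxA -scalar_mxC mulmxA mulVmx // mul1mx.
Qed.

Lemma sym_two_eigenvalues (R : realType) n (A : 'M[R]_n) a b : A^T = A ->
  (forall x, eigenvalue A x -> x = a \/ x = b) -> (A - a%:M) *m (A - b%:M) = 0.
Proof.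
move=> /real_spectral[P [d Pu [Ad dP]]] Aab.
apply: (@map_real_complex_inj R).
pose D c := diag_mx (map_mx (real_complex R) (d - const_mx c)).
have DD : D a *m D b = 0.
  rewrite mulmx_diag; apply/matrixP => i j; rewrite !mxE -rmorphM /=.
  by case: (Aab _ (dP i)) => ->; rewrite subrr ?mulr0 ?mul0r rmorph0 mul0rn.
have E c : map_mx (real_complex R) (A - c%:M) = invmx P *m D c *m P.
  have -> : D c = diag_mx (map_mx (real_complex R) d) - (real_complex R c)%:M.
    by rewrite -diag_const_mx -linearB /= -map_const_mx -map_mxB.
  rewrite map_mxB Ad map_scalar_mx mulmxBr mulmxBl.
  by rewrite -[invmx P *m _%:M *m P]mulmxA -scalar_mxC mulmxA mulVmx // mul1mx.
have PV : P *m invmx P = 1%:M by rewrite mulmxV.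
rewrite map_mxM (E a) (E b) map_mx0; move: (D a) (D b) (invmx P) DD PV => D1 D2 P' DD PV.
by rewrite -!mulmxA (mulmxA P) PV mul1mx (mulmxA D1) DD mul0mx mulmx0.
Qed.

Lemma mem_eigenvalues (R : realType) n (A : 'M[R]_n) x :
  (x \in fset_set (eigenvalues A)) = eigenvalue A x.
Proof.
rewrite in_fset_set; last exact: eigenvalues_finite.
by apply/idP/idP => [/set_mem|Ax] //; apply: mem_set.
Qed.

Lemma num_eigenvalues_le (R : realType) n (A : 'M[R]_n) (rs : seq R) :
  (forall a, eigenvalue A a -> a \in rs) -> (num_eigenvalues A <= size rs)%N.
Proof.
move=> Ars; rewrite /num_eigenvalues.
have sub : (fset_set (eigenvalues A) `<=` [fset x in rs])%fset.
  apply/fsubsetP => x; rewrite mem_eigenvalues => /Ars; by rewrite inE.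
apply: leq_trans (fsubset_leq_card sub) _.
by rewrite card_fseq size_undup.
Qed.

(** A symmetric matrix with at most one eigenvalue is scalar, whereas the join of two nonempty
    graphs has an edge. *)
Lemma num_eigenvalues_gt1 (R : realType) m n (G : sgraph m) (H : sgraph n)
    (A : 'M[R]_(m + n)) :
  (0 < m)%N -> (0 < n)%N -> symmat (join G H) A -> (1 < num_eigenvalues A)%N.
Proof.
move=> m0 n0 [Asym AE].
suff N a : ~ (forall x, eigenvalue A x -> x = a).
  rewrite ltnNge; apply/negP; rewrite /num_eigenvalues.
  have mem x : eigenvalue A x -> x \in fset_set (eigenvalues A).
    by rewrite mem_eigenvalues.
  rewrite leq_eqVlt ltnS leqn0 => /orP[/cardfs1P[a Aa]|].
    by apply: (N a) => x /mem; rewrite Aa inE => /eqP.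
  rewrite cardfs_eq0 => /eqP A0.
  (* If the set of eigenvalues were empty, the claim would hold vacuously for any value; 0 is
     taken. *)
  by apply: (N 0) => x /mem; rewrite A0 inE.
move=> /(sym_one_eigenvalue Asym) Aa.
have xy : lshift n (Ordinal m0) != rshift m (Ordinal n0) by rewrite eq_lrshift.
have := AE _ _ xy; rewrite /= /join_edge.
rewrite (unsplitK (inl (Ordinal m0))) (unsplitK (inr (Ordinal n0))).
by rewrite Aa mxE (negPf xy) mulr0n eqxx.
Qed.

Lemma orthogonal_num_eigenvalues (R : realType) n (A : 'M[R]_n) :
  A^T = A -> A *m A^T = 1%:M -> (num_eigenvalues A <= 2)%N.
Proof.
move=> As AA; apply: (@num_eigenvalues_le R n A [:: 1; -1]) => a /eigenvalueP[v vA v0].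
have : a ^+ 2 *: v = v.
  by rewrite -[RHS]mulmx1 -AA As mulmxA vA -scalemxAl vA scalerA.
move=> /eqP; rewrite -subr_eq0 -[X in _ - X]scale1r -scalerBl scaler_eq0 (negPf v0) orbF.
by rewrite subr_eq0 sqrf_eq1 !inE.
Qed.

Lemma cubic_num_eigenvalues (R : realType) n (A : 'M[R]_n) s :
  A *m A *m A = s ^+ 2 *: A -> (num_eigenvalues A <= 3)%N.
Proof.
move=> A3; apply: (@num_eigenvalues_le R n A [:: 0; s; -s]) => a /eigenvalueP[v vA v0].
have : a * (a ^+ 2 - s ^+ 2) == 0.
  have : (a * (a ^+ 2 - s ^+ 2)) *: v = 0.
    rewrite mulrBr scalerBl; apply/eqP; rewrite subr_eq0; apply/eqP.
    have := congr1 (mulmx v) A3; rewrite -scalemxAr !mulmxA !(vA, =^~ scalemxAl, scalerA).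
    by move=> E; rewrite [a * s ^+ 2]mulrC -E -exprS exprSr expr2.
  by move/eqP; rewrite scaler_eq0 (negPf v0) orbF.
by rewrite mulf_eq0 subr_eq0 eqf_sqr !inE.
Qed.

Lemma two_eigenvalues_orthogonal (R : realType) n (K : sgraph n) (A : 'M[R]_n) :
  symmat K A -> num_eigenvalues A = 2%N ->
  exists2 B : 'M[R]_n, symmat K B & B *m B^T = 1%:M.
Proof.
move=> [As AE] A2.
have [a [b [ab Eab]]] : exists a b, a != b /\ forall x, eigenvalue A x -> x \in [:: a; b].
  have : forall x, eigenvalue A x -> x \in enum_fset (fset_set (eigenvalues A)).
    by move=> x; rewrite -mem_eigenvalues.
  move: (fset_uniq (fset_set (eigenvalues A))) A2; rewrite /num_eigenvalues.
  case: (enum_fset _) => [|a [|b [|c r]]] //= /andP[]; rewrite inE => ab _ _ rP.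
  by exists a, b.
have E x : eigenvalue A x -> x = a \/ x = b.
  by move=> /Eab; rewrite !inE => /orP[]/eqP->; [left|right].
have Aq := sym_two_eigenvalues As E.
have d0 : a - b != 0 by rewrite subr_eq0.
(* The affine map that sends [a] to 1 and [b] to -1; it multiplies off-diagonal entries by a nonzero
   factor, so the graph is unchanged. *)
pose B := (2 / (a - b)) *: A - ((a + b) / (a - b))%:M.
have BT : B^T = B by rewrite /B linearB /= linearZ /= tr_scalar_mx As.
exists B; first split => // i j ij.
  rewrite -AE // !mxE (negPf ij) mulr0n subr0 mulf_eq0 negb_or.
  have -> : 2 / (a - b) != 0 by rewrite mulf_neq0 ?invr_eq0 ?pnatr_eq0.
  by [].
have AA : A *m A = (a + b) *: A - (a * b)%:M.
  move: Aq; rewrite mulmxBr !mulmxBl mul_mx_scalar mul_scalar_mx -scalar_mxM.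
  move=> /eqP; rewrite subr_eq0 => /eqP /(canRL (subrK _)) ->.
  by rewrite addrAC scalerDl [b *: A + _]addrC.
have BB : B *m B = (2 / (a - b)) ^+ 2 *: (A *m A)
    - (2 * (2 / (a - b)) * ((a + b) / (a - b))) *: A + (((a + b) / (a - b)) ^+ 2)%:M.
  rewrite /B; move: (2 / (a - b)) ((a + b) / (a - b)) => x y.
  rewrite mulmxBr !mulmxBl mul_mx_scalar mul_scalar_mx -scalemxAl -scalemxAr -scalar_mxM.
  move: (A *m A) => Z; apply/matrixP => i j; rewrite !mxE.
  by case: (i == j); rewrite ?(mulr0n, mulr1n); ring.
rewrite BT BB AA; apply/matrixP => i j; rewrite !mxE.
by case: (i == j); rewrite ?(mulr0n, mulr1n); field.
Qed.

(** * Generic reflections *)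

(** The product of the nonzero members has fewer roots than its size, so one of sufficiently many
    natural numbers is not a root. *)
Lemma poly_nonroot (R : numDomainType) (ps : seq {poly R}) :
  exists t, forall p, p \in ps -> p != 0 -> p.[t] != 0.
Proof.
pose P := \prod_(p <- ps | p != 0) p.
have P0 : P != 0 by rewrite prodf_seq_neq0; apply/allP => p _; apply/implyP.
have [t Pt] : exists t, ~~ root P t.
  apply/not_existsP => Proot.
  pose rs := [seq i%:R : R | i <- iota 0 (size P)].
  have : (size rs < size P)%N.
    apply: max_poly_roots => //; first by apply/allP => x _; have /negP := Proot x; rewrite negbK.
    by rewrite map_inj_uniq ?iota_uniq // => i j /eqP; rewrite eqr_nat => /eqP.
  by rewrite size_map size_iota ltnn.
exists t => p pps p0; apply: contra Pt => /eqP pt.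
by rewrite /root /P horner_prod (big_rem p) //= p0 pt mul0r.
Qed.

(* (1 + t^2) times the Householder reflection along e_b + t e_c; at t = 0 it is
   diagonal with entries 1 and -1, so conjugating by it for small or generic t
   keeps every nonzero entry nonzero. *)
Definition hvec (R : comNzRingType) N (b c : 'I_N) (t : R) : 'cV[R]_N :=
  delta_mx b 0 + t *: delta_mx c 0.

Definition hmx (R : comNzRingType) N (b c : 'I_N) (t : R) : 'M[R]_N :=
  (1 + t ^+ 2)%:M - 2 *: (hvec b c t *m (hvec b c t)^T).

Lemma hmx_sym (R : comNzRingType) N (b c : 'I_N) (t : R) : (hmx b c t)^T = hmx b c t.
Proof. by rewrite /hmx linearB /= linearZ /= trmx_mul trmxK tr_scalar_mx. Qed.

Lemma hvecE (R : comNzRingType) N (b c : 'I_N) (t : R) x :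
  hvec b c t x 0 = (x == b)%:R + t * (x == c)%:R.
Proof. by rewrite !mxE !eqxx !andbT. Qed.

Lemma hmxE (R : comNzRingType) N (b c : 'I_N) (t : R) x y :
  hmx b c t x y = (1 + t ^+ 2) *+ (x == y) - 2 * (hvec b c t x 0 * hvec b c t y 0).
Proof.
have E (M M' : 'M[R]_N) : (M - 2 *: M') x y = M x y - 2 * M' x y by rewrite !mxE.
by rewrite /hmx E [_%:M x y]mxE [(_ *m _) x y]mxE big_ord1 [_^T _ _]mxE.
Qed.

Lemma mul_hmxE (R : comNzRingType) N (A : 'M[R]_N) (b c : 'I_N) (t : R) x y :
  (hmx b c t *m A) x y =
    (1 + t ^+ 2) * A x y - 2 * (hvec b c t x 0 * (A b y + t * A c y)).
Proof.
have -> : A b y + t * A c y = ((hvec b c t)^T *m A) 0 y.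
  rewrite /hvec linearD /= linearZ /= !trmx_delta mulmxDl -scalemxAl -!rowE.
  by rewrite !mxE.
rewrite /hmx mulmxBl mul_scalar_mx -scalemxAl -mulmxA.
have E (M M' : 'M[R]_N) : ((1 + t ^+ 2) *: M - 2 *: M') x y =
  (1 + t ^+ 2) * M x y - 2 * M' x y by rewrite !mxE.
by rewrite E [(hvec b c t *m _) x y]mxE big_ord1.
Qed.

Lemma conj_hmxE (R : comNzRingType) N (A : 'M[R]_N) (b c : 'I_N) (t : R) x y :
  let Z x y := (1 + t ^+ 2) * A x y - 2 * (hvec b c t x 0 * (A b y + t * A c y)) in
  (hmx b c t *m A *m hmx b c t) x y =
    (1 + t ^+ 2) * Z x y - 2 * (hvec b c t y 0 * (Z x b + t * Z x c)).
Proof.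
move=> Z; have T (M : 'M[R]_N) i j : M i j = M^T j i by rewrite mxE.
by rewrite T trmx_mul hmx_sym mul_hmxE -!T !mul_hmxE.
Qed.

(** At parameter 0 only signs change, so 0 witnesses that the polynomial attached to an already
    nonzero entry is nonzero. *)
Lemma conj_hmx0 (R : comNzRingType) N (A : 'M[R]_N) (b c : 'I_N) x y :
  (hmx b c 0 *m A *m hmx b c 0) x y = (-1) ^+ (x == b) * (-1) ^+ (y == b) * A x y.
Proof.
rewrite conj_hmxE !hvecE !(mul0r, addr0, expr0n, mul1r) /=.
case: (eqVneq x b) => [->|_]; case: (eqVneq y b) => [->|_];
  rewrite /= ?(expr0, expr1, mulr0n, mulr1n); ring.
Qed.

Lemma hmx_sqr (R : comNzRingType) N (b c : 'I_N) (t : R) : b != c ->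
  hmx b c t *m hmx b c t = ((1 + t ^+ 2) ^+ 2)%:M.
Proof.
move=> bc; apply/matrixP => x y; rewrite mul_hmxE !hmxE [RHS]mxE.
rewrite [hvec b c t b 0]hvecE [hvec b c t c 0]hvecE !eqxx (negPf bc) [c == b]eq_sym (negPf bc).
rewrite [hvec b c t y 0]hvecE [b == y]eq_sym [c == y]eq_sym.
move: (hvec b c t x 0) => u.
by case: (x == y); case: (y == b); case: (y == c); rewrite /= ?(mulr0n, mulr1n); ring.
Qed.

(** Up to the factor [(1 + t ^+ 2) ^- 2], each entry of the conjugate is a polynomial in [t]. Every
    conclusion asks that some such polynomial, or a difference of two, not vanish; each is shown
    nonzero at one particular parameter, and a single [t] then avoids all the roots. *)
Lemma generic_reflection (R : realFieldType) N (A : 'M[R]_N) (b c : 'I_N) :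
  A^T = A -> b != c -> exists Q : 'M[R]_N,
  [/\ Q^T = Q, Q *m Q = 1%:M &
      forall x y, Q x y != 0 -> x = y \/ x \in [:: b; c] /\ y \in [:: b; c]] /\
  let B := Q *m A *m Q in
  [/\ forall x y, A x y != 0 -> B x y != 0,
      forall x y, A x x != A y y -> B x x != B y y,
      forall x, x != b -> x != c -> A x c != 0 -> B x b != 0
    & A b b != A c c -> B b c != 0].
Proof.
move=> As bc.
have [h hE] : exists h : 'I_N -> {poly R}, forall x t, (h x).[t] = hvec b c t x 0.
  exists (fun x => (x == b)%:R + 'X * (x == c)%:R) => x t.
  by rewrite hvecE; case: (x == b); case: (x == c); rewrite /= !hornerE.
pose Z x y := (1 + 'X ^+ 2) * (A x y)%:P - 2 * (h x * ((A b y)%:P + 'X * (A c y)%:P)).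
pose P x y := (1 + 'X ^+ 2) * Z x y - 2 * (h y * (Z x b + 'X * Z x c)).
have n1 t : (1 : {poly R}).[t] = 1 by rewrite hornerC.
have n2 t : (2 : {poly R}).[t] = 2 by rewrite -polyC_natr hornerC.
have PE x y t : (P x y).[t] = (hmx b c t *m A *m hmx b c t) x y.
  by rewrite conj_hmxE /P /Z !(n2, n1, hE, hornerXn, hornerX, hornerC, hornerD, hornerN, hornerM).
pose ps := [seq P x y | x <- enum 'I_N, y <- enum 'I_N] ++
           [seq P x x - P y y | x <- enum 'I_N, y <- enum 'I_N].
have [t tP] := poly_nonroot ps.
have tP1 x y s : (P x y).[s] != 0 -> (P x y).[t] != 0.
  move=> s0; apply: tP; last by apply: contraNneq s0 => ->; rewrite horner0.
  by rewrite mem_cat allpairs_f ?mem_enum.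
have tP2 x y s : (P x x).[s] != (P y y).[s] -> (P x x).[t] != (P y y).[t].
  rewrite -subr_eq0 -hornerN -hornerD => s0; rewrite -subr_eq0 -hornerN -hornerD.
  apply: tP; last by apply: contraNneq s0 => ->; rewrite horner0.
  by rewrite mem_cat (allpairs_f (fun x y => P x x - P y y)) ?mem_enum // orbT.
have t0 : 1 + t ^+ 2 != 0 by rewrite gt_eqF // ltr_wpDr ?sqr_ge0.
pose Q := (1 + t ^+ 2)^-1 *: hmx b c t.
have BE : Q *m A *m Q = (1 + t ^+ 2) ^- 2 *: (hmx b c t *m A *m hmx b c t).
  by rewrite /Q -!scalemxAl -scalemxAr scalerA -exprVn.
have t2 : (1 + t ^+ 2) ^- 2 != 0 by rewrite invr_eq0 expf_neq0.
have BP x y : (Q *m A *m Q) x y = (1 + t ^+ 2) ^- 2 * (P x y).[t].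
  by rewrite BE mxE PE.
exists Q; split; [split|split].
- by rewrite /Q linearZ /= hmx_sym.
- rewrite /Q -scalemxAl -scalemxAr scalerA hmx_sqr // scale_scalar_mx.
  by rewrite -expr2 -exprMn mulVf // expr1n.
- move=> x y; rewrite [Q x y]mxE hmxE !hvecE; have [->|xy] := eqVneq x y; first by left.
  rewrite !inE; case: (x == b); case: (x == c); case: (y == b); case: (y == c) => //=;
    rewrite ?(mulr0, mul0r, addr0, mulr0n, subr0, eqxx) //; by right.
- move=> x y A0; rewrite BP mulf_neq0 //; apply: (tP1 _ _ 0).
  by rewrite PE conj_hmx0 mulf_neq0 // mulf_neq0 // signr_eq0.
- move=> x y A0; rewrite !BP (inj_eq (mulfI t2)); apply: (tP2 _ _ 0).
  by rewrite !PE !conj_hmx0 -!signr_addb !addbb !mul1r.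
(* At [t = 1] the reflection exchanges the basis vectors of [b] and [c] up to sign, which brings
   [A x c] to position [(x, b)]. *)
- move=> x xb xc A0; rewrite BP mulf_neq0 //; apply: (tP1 _ _ 1).
  rewrite PE conj_hmxE !hvecE (negPf xb) (negPf xc) eqxx (negPf bc).
  apply: contraNneq A0; rewrite /= => E; apply/eqP; lra.
- move=> A0; rewrite BP mulf_neq0 //.
  have Acb : A c b = A b c by rewrite -{1}As mxE.
  have [Abc|Abc] := eqVneq (A b c) 0; last first.
    by apply: (tP1 _ _ 0); rewrite PE conj_hmx0 mulf_neq0 // mulf_neq0 // signr_eq0.
  (* With [A b c = 0] the entry is [2 t (t^2 - 1) (A c c - A b b)]; it vanishes at 0 and 1, hence
     the parameter 2. *)
  apply: (tP1 _ _ 2); rewrite PE conj_hmxE !hvecE !eqxx (negPf bc) [c == b]eq_sym (negPf bc).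
  by apply: contraNneq A0; rewrite /= Acb Abc => E; apply/eqP; lra.
Qed.

(* Conjugation by generic reflections in planes spanned by two vertices of the
   same class spreads one nonzero entry to its whole block. *)
Lemma spread_nonzero (R : realFieldType) N (J : eqType) (cl : 'I_N -> J) (K : rel 'I_N)
    (A0 : 'M[R]_N) :
  A0^T = A0 ->
  (forall x y x' y', cl x = cl x' -> cl y = cl y' -> x != y -> x' != y' -> K x y = K x' y') ->
  (forall x y, cl x = cl y -> x != y -> K x y) ->
  (forall x y, x != y -> ~~ K x y -> A0 x y = 0) ->
  (forall x y, x != y -> K x y -> exists x' y', [/\ cl x' = cl x, cl y' = cl y &
     x' != y' /\ A0 x' y' != 0 \/ cl x = cl y /\ A0 x' x' != A0 y' y']) ->
  exists2 Q : 'M[R]_N, Q *m Q^T = 1%:M &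
    forall x y, x != y -> ((Q *m A0 *m Q^T) x y != 0) = K x y.
Proof.
move=> + hK1 hK2.
(* Induction on the number of off-diagonal zeros: each reflection preserves the nonzero entries and
   fills at least one zero. *)
pose zeros (A : 'M[R]_N) := #|[set z : 'I_N * 'I_N | (z.1 != z.2) && (A z.1 z.2 == 0)]|.
have [k] := ubnP (zeros A0); elim: k A0 => // k IH A Ak As hN hW.
have [/forallP done|] := boolP [forall x, forall y, (x != y) ==> K x y ==> (A x y != 0)].
  exists 1%:M; first by rewrite trmx1 mulmx1.
  move=> x y xy; rewrite trmx1 mulmx1 mul1mx; apply/idP/idP.
    by apply: contraR => nK; rewrite hN.
  by move=> Kxy; have /forallP/(_ y)/implyP/(_ xy)/implyP/(_ Kxy) := done x.
move=> /forallPn[x /forallPn[y]]; rewrite negb_imply => /andP[xy].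
rewrite negb_imply => /andP[Kxy /negPn/eqP Axy].
have A_sym u v : A u v = A v u by rewrite -[in LHS]As mxE.
suff [b [c [u [v [bc cbc uv [Auv gain]]]]]] : exists b c u v, [/\ b != c, cl b = cl c, u != v &
    A u v = 0 /\ (u != b /\ u != c /\ A u c != 0 /\ v = b \/
      A b b != A c c /\ u = b /\ v = c)].
  have [Q [[Qs QQ Qloc] [B1 B2 B3 B4]]] := generic_reflection As bc.
  set B := Q *m A *m Q in B1 B2 B3 B4.
  have Qcl i j : Q i j != 0 -> cl i = cl j.
    by case/Qloc => [->//|[]]; rewrite !inE => /orP[]/eqP-> /orP[]/eqP->.
  have Bs : B^T = B by rewrite /B !trmx_mul Qs As mulmxA.
  have [||||P PP PB] := IH B.
  - rewrite -ltnS; apply: leq_trans Ak; rewrite ltnS; apply: proper_card; apply/properP; split.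
      apply/fintype.subsetP => -[i j]; rewrite !finset.inE /= => /andP[-> /=].
      by apply: contraLR; apply: B1.
    exists (u, v); rewrite !finset.inE /= uv /= ?Auv ?eqxx //.
    case: gain => [[ub [uc [Auc ->]]]|[Ab [-> ->]]]; [exact: B3 | exact: B4].
  - exact: Bs.
  (* [Q] mixes only indices of equal class, and [K] depends only on classes off the diagonal, so
     blocks forbidden by [K] stay zero. *)
  - move=> i j ij nK; rewrite /B mxE big1 // => w _.
    have [->|Qw] := eqVneq (Q w j) 0; first by rewrite mulr0.
    rewrite mxE big1 ?mul0r // => s _.
    have [->|Qs'] := eqVneq (Q i s) 0; first by rewrite mul0r.
    have cij : cl i != cl j by apply: contra nK => /eqP cij; apply: hK2.
    have sw : s != w.
      by apply: contra cij => /eqP sw; rewrite (Qcl _ _ Qs') sw (Qcl _ _ Qw).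
    rewrite hN ?mulr0 //; apply: contra nK.
    by rewrite (hK1 s w i j) ?(Qcl _ _ Qs') ?(Qcl _ _ Qw).
  - move=> i j ij Kij; have [i' [j' [ci cj H]]] := hW i j ij Kij.
    exists i', j'; split => //; case: H => [[ij' Aij]|[cij Aij]]; [left|right]; split=> //.
      exact: B1.
    exact: B2.
  exists (P *m Q).
    by rewrite trmx_mul mulmxA -[P *m Q *m _]mulmxA Qs QQ mulmx1.
  move=> i j ij; rewrite -PB // trmx_mul Qs /B !mulmxA //.
have [x' [y' [cx cy H]]] := hW x y xy Kxy.
(* If the diagonal entries differ but [A x' y'] is already nonzero, the first alternative applies;
   otherwise [(x', y')] itself is the zero to fill. *)
have [[xy' Axy']|{H}[x'y' cxy Axy']] : (x' != y' /\ A x' y' != 0) \/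
    [/\ x' != y', cl x = cl y, A x' x' != A y' y' & A x' y' = 0].
- case: H => [|[cxy Axy']]; first by left.
  have xy' : x' != y' by apply: contraNneq Axy' => ->.
  by have [A0|A1] := eqVneq (A x' y') 0; [right|left].
(* The nonzero value at [(x', y')] travels towards [(x, y)] by changing one index at a time. When
   [A x y' = 0], the zero filled is the one at [(y', x)], which is progress enough. The case
   [x = y'] is separate because the intermediate position would be diagonal. *)
- have [xy'E|xNy'] := eqVneq x y'.
    have yx' : y != x'.
      by apply/eqP => yx'; move: Axy'; rewrite -yx' -xy'E (A_sym y x) Axy eqxx.
    exists y, x', x, y; split => //; first by rewrite cx xy'E cy.
    split => //; left; split => //; split; first by rewrite xy'E eq_sym.
    by rewrite (A_sym x x') xy'E.
  have [Axy0|Axy1] := eqVneq (A x y') 0.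
    have xx' : x != x' by apply/eqP => xx'; move: Axy'; rewrite -xx' Axy0 eqxx.
    exists x, x', y', x; split => //; first by rewrite eq_sym.
    split; first by rewrite A_sym.
    by left; split; [rewrite eq_sym | split; [rewrite eq_sym | rewrite A_sym]].
  have yy' : y != y' by apply/eqP => yy'; move: Axy1; rewrite -yy' Axy eqxx.
  by exists y, y', x, y; split => //; split => //; left.
- by exists x', y', x', y'; split=> //; [rewrite cx cy | split => //; right].
Qed.

(** * Realizing the pattern of a join *)

Lemma join_edgeE m n (G : sgraph m) (H : sgraph n) :
  ((forall i j, join_edge G H (lshift n i) (lshift n j) = G i j) *
   (forall i j, join_edge G H (rshift m i) (rshift m j) = H i j) *
   (forall i j, join_edge G H (lshift n i) (rshift m j) = true) *
   (forall i j, join_edge G H (rshift m i) (lshift n j) = true))%type.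
Proof.
have L i : fintype.split (lshift n i) = inl i := unsplitK (inl i).
have R i : fintype.split (rshift m i) = inr i := unsplitK (inr i).
by split; [split; [split|]|] => i j; rewrite /join_edge ?L ?R.
Qed.

(** With complete components, adjacency of distinct vertices of the join depends only on their
    components, so [spread_nonzero] applies with the components of both sides as classes. The
    hypotheses supply its seeds: a nonzero entry of [B] in each cross block, and two different
    diagonal values in each component of size at least 2. *)
Lemma join_realization (R : realType) m n (G : sgraph m) (H : sgraph n)
    (a : 'rV[R]_m) (b : 'rV[R]_n) (B : 'M[R]_(m, n)) :
  complete_components G -> complete_components H ->
  (forall x y, exists x' y', [/\ rep G x' = rep G x, rep H y' = rep H y & B x' y' != 0]) ->
  (forall x1 x2, x1 != x2 -> rep G x1 = rep G x2 ->
     exists u v, [/\ rep G u = rep G x1, rep G v = rep G x1 & a 0 u != a 0 v]) ->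
  (forall y1 y2, y1 != y2 -> rep H y1 = rep H y2 ->
     exists u v, [/\ rep H u = rep H y1, rep H v = rep H y1 & b 0 u != b 0 v]) ->
  let A := block_mx (diag_mx a) B B^T (diag_mx b) in
  exists2 Q : 'M[R]_(m + n), Q *m Q^T = 1%:M & symmat (join G H) (Q *m A *m Q^T).
Proof.
move=> cG cH hB hG hH A.
have As : A^T = A by rewrite tr_block_mx !tr_diag_mx trmxK.
pose cl z : 'I_m + 'I_n := match fintype.split z with
  inl x => inl (rep G x) | inr y => inr (rep H y) end.
have clL x : cl (lshift n x) = inl (rep G x) by rewrite /cl (unsplitK (inl x)).
have clR y : cl (rshift m y) = inr (rep H y) by rewrite /cl (unsplitK (inr y)).
have eG x y : x != y -> G x y = (rep G x == rep G y).
  move=> xy; apply/idP/eqP => [/edge_rep //|rxy]; exact: complete_componentsE.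
have eH x y : x != y -> H x y = (rep H x == rep H y).
  move=> xy; apply/idP/eqP => [/edge_rep //|rxy]; exact: complete_componentsE.
have [||||Q QQ QA] := @spread_nonzero R (m + n) _ cl (join_edge G H) A As.
- move=> x y x' y'.
  case: (split_ordP x) => {}x ->; case: (split_ordP x') => {}x' ->; rewrite ?clL ?clR // => -[rx];
  case: (split_ordP y) => {}y ->; case: (split_ordP y') => {}y' ->; rewrite ?clL ?clR // => -[ry];
  rewrite ?join_edgeE // ?(inj_eq (@lshift_inj _ _)) ?(inj_eq (@rshift_inj _ _)) => xy xy'.
    by rewrite !eG // rx ry.
  by rewrite !eH // rx ry.
- move=> x y; case: (split_ordP x) => {}x ->; case: (split_ordP y) => {}y ->;
  rewrite ?clL ?clR // => -[rxy]; rewrite ?join_edgeE ?(inj_eq (@lshift_inj _ _)) ?(inj_eq (@rshift_inj _ _)) => xy.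
    by rewrite eG ?rxy.
  by rewrite eH ?rxy.
- move=> x y; case: (split_ordP x) => {}x ->; case: (split_ordP y) => {}y ->;
  rewrite ?join_edgeE // ?(inj_eq (@lshift_inj _ _)) ?(inj_eq (@rshift_inj _ _)) => xy _.
    by rewrite block_mxEul mxE (negPf xy).
  by rewrite block_mxEdr mxE (negPf xy).
- move=> x y; case: (split_ordP x) => {}x ->; case: (split_ordP y) => {}y ->;
  rewrite ?join_edgeE ?(inj_eq (@lshift_inj _ _)) ?(inj_eq (@rshift_inj _ _)) => xy exy.
  + move: exy; rewrite eG // => /eqP rxy; have [u [v [ru rv auv]]] := hG x y xy rxy.
    exists (lshift n u), (lshift n v); rewrite !clL ru rv rxy; split=> //; right.
    by rewrite !block_mxEul !mxE !eqxx.
  + have [x' [y' [rx ry Bxy]]] := hB x y.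
    exists (lshift n x'), (rshift m y'); rewrite !clL !clR rx ry; split=> //; left.
    by rewrite block_mxEur eq_lrshift.
  + have [y' [x' [ry rx Bxy]]] := hB y x.
    exists (rshift m x'), (lshift n y'); rewrite !clL !clR rx ry; split=> //; left.
    by rewrite block_mxEdl mxE eq_rlshift.
  + move: exy; rewrite eH // => /eqP rxy; have [u [v [ru rv auv]]] := hH x y xy rxy.
    exists (rshift m u), (rshift m v); rewrite !clR ru rv rxy; split=> //; right.
    by rewrite !block_mxEdr !mxE !eqxx.
exists Q => //; split; last exact: QA.
by rewrite !trmx_mul trmxK As mulmxA.
Qed.

(** * Constructions from colourings *)

Lemma nowhere_zero_orthogonal (R : realFieldType) c :
  exists2 K : 'M[R]_c, K *m K^T = 1%:M & forall i j, K i j != 0.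
Proof.
case: c => [|c]; first by exists 1%:M; [rewrite trmx1 mulmx1 | case].
(* Householder reflection along [(c+1, 1, ..., 1)], whose squared norm is [s]. A diagonal entry
   vanishes only if [s] is twice the square of a coordinate, which is excluded by size; the all-ones
   vector would fail in dimension 2. *)
pose w (i : 'I_c.+1) : nat := if i == 0 then c.+1 else 1%N.
pose s := (c.+1 ^ 2 + c)%N.
pose u : 'cV[R]_c.+1 := \col_i (w i)%:R.
have s0 : s%:R != 0 :> R by rewrite pnatr_eq0 /s expnS.
have uu : u^T *m u = (s%:R)%:M.
  apply/matrixP => i j; rewrite !ord1 !mxE eqxx mulr1n.
  under eq_bigr do rewrite !mxE -natrM.
  rewrite -natr_sum; congr _%:R; rewrite big_ord_recl /w eqxx /s mulnn; congr (_ + _)%N.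
  by rewrite (eq_bigr (fun=> 1%N)) // sum_nat_const card_ord muln1.
pose K : 'M[R]_c.+1 := 1%:M - (2 / s%:R) *: (u *m u^T).
have KT : K^T = K by rewrite /K linearB /= linearZ /= trmx_mul trmxK trmx1.
exists K.
  rewrite KT /K mulmxBl mul1mx -scalemxAl mulmxBr mulmx1 -scalemxAr.
  rewrite -mulmxA [u^T *m (_ *m _)]mulmxA uu mul_scalar_mx -scalemxAr scalerBr !scalerA.
  have -> : 2 / s%:R * (2 / s%:R * s%:R) = 2 / s%:R + 2 / s%:R :> R by field.
  rewrite scalerDl; move: (_ *: _) => Z.
  by apply/matrixP => i j; rewrite !mxE; ring.
move=> i j; rewrite /K !mxE big_ord1 !mxE; have [<-|ij] := eqVneq i j; last first.
  by rewrite sub0r oppr_eq0 !mulf_neq0 ?invr_eq0 ?pnatr_eq0 // /w; case: ifP.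
apply/negP; rewrite subr_eq0 => /eqP E.
have : s%:R = (2 * (w i * w i))%:R :> R.
  apply: (mulfI (invr_neq0 s0)); rewrite mulVf // !natrM; apply: etrans E _.
  by rewrite [2 / _]mulrC -mulrA.
move/eqP; rewrite eqr_nat /s /w; case: (eqVneq i 0) => [_|i0] /eqP; first by nia.
have : (0 < i)%N by rewrite lt0n; apply: contra i0 => /eqP i0; apply/eqP/val_inj.
by have := ltn_ord i; nia.
Qed.

Lemma enum_injection (T : finType) (S : {set T}) c : #|S| = c ->
  exists2 f : 'I_c -> T, injective f & forall x, (x \in S) = [exists i, f i == x].
Proof.
move=> <-; exists enum_val; first exact: enum_val_inj.
move=> x; apply/idP/existsP => [xS|[i /eqP <-]]; last exact: enum_valP.
by exists (enum_rank_in xS x); rewrite enum_rankK_in.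
Qed.

(** A nowhere zero orthogonal matrix is transported to [S] and [T] by 0-1 selection matrices with
    orthonormal columns. *)
Lemma partial_isometry (R : realFieldType) m n (S : {set 'I_m}) (T : {set 'I_n}) :
  #|S| = #|T| -> exists U : 'M[R]_(m, n),
  [/\ U *m U^T = diag_mx (\row_x (x \in S)%:R),
      U^T *m U = diag_mx (\row_y (y \in T)%:R)
    & forall x y, (U x y != 0) = (x \in S) && (y \in T)].
Proof.
move=> ST; have [f fI fS] := enum_injection ST; have [g gI gT] := enum_injection (erefl #|T|).
have [K KK K0] := nowhere_zero_orthogonal R #|T|.
pose E k (h : 'I_#|T| -> 'I_k) : 'M[R]_(k, #|T|) := \matrix_(x, i) (h i == x)%:R.
have ETE k h : injective h -> (E k h)^T *m E k h = 1%:M.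
  move=> hI; apply/matrixP => i j; rewrite !mxE (bigD1 (h i)) //= !mxE eqxx mul1r.
  rewrite big1 ?addr0 => [|x xh]; first by rewrite (inj_eq hI) eq_sym.
  by rewrite !mxE eq_sym (negPf xh) mul0r.
have EET k h (W : {set 'I_k}) : injective h -> (forall x, (x \in W) = [exists i, h i == x]) ->
    E k h *m (E k h)^T = diag_mx (\row_x (x \in W)%:R).
  move=> hI hW; apply/matrixP => x y; rewrite !mxE hW.
  case: existsP => [[i /eqP <-]|N].
    rewrite (bigD1 i) //= !mxE eqxx mul1r big1 ?addr0 // => j ji.
    by rewrite !mxE (inj_eq hI) (negPf ji) mul0r.
  rewrite mul0rn big1 // => i _; rewrite !mxE.
  by case: eqP => [hx|_]; [case: N; exists i; apply/eqP | rewrite mul0r].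
have KK' : K^T *m K = 1%:M by apply: mulmx1C.
exists (E _ f *m K *m (E _ g)^T); split.
- rewrite !trmx_mul trmxK !mulmxA -[_ *m E _ g]mulmxA ETE // mulmx1.
  by rewrite -[_ *m K^T]mulmxA KK mulmx1; apply: EET.
- rewrite !trmx_mul trmxK !mulmxA -[_ *m E _ f]mulmxA ETE // mulmx1.
  by rewrite -[_ *m K]mulmxA KK' mulmx1; apply: EET.
- move=> x y; rewrite fS gT.
  case: existsP => [[i /eqP <-]|N] /=; last first.
    rewrite -mulmxA mxE big1 ?eqxx // => i _; rewrite mxE.
    by case: eqP => [hx|_]; [case: N; exists i; apply/eqP | rewrite mul0r].
  case: existsP => [[j /eqP <-]|N] /=; last first.
    rewrite mxE big1 ?eqxx // => j _; rewrite !mxE.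
    by case: eqP => [hx|_]; [case: N; exists j; apply/eqP | rewrite mulr0].
  rewrite mxE (bigD1 j) //= !mxE eqxx mulr1 [X in _ + X]big1 ?addr0; last first.
    by move=> k kj; rewrite !mxE (inj_eq gI) (negPf kj) mulr0.
  rewrite (bigD1 i) //= !mxE eqxx mul1r big1 ?addr0 //.
    by rewrite K0.
  by move=> k ki; rewrite !mxE (inj_eq fI) (negPf ki) mul0r.
Qed.

(* Vertices of G in S s carry the eigenvalue +-3/5 of X, coupled by a partial
   isometry scaled by 4/5 to the vertices of H in T s, which carry the opposite
   eigenvalue of Y; the remaining vertices carry 1 in G and -1 in H, uncoupled. *)
Lemma coloring_orthogonal (R : realType) m n (G : sgraph m) (H : sgraph n)
    (S : bool -> {set 'I_m}) (T : bool -> {set 'I_n}) :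
  complete_components G -> complete_components H ->
  [disjoint S true & S false] -> [disjoint T true & T false] ->
  (forall s, #|S s| = #|T s|) ->
  (forall x y, exists s x' y',
     [/\ rep G x' = rep G x, rep H y' = rep H y, x' \in S s & y' \in T s]) ->
  (forall x1 x2, x1 != x2 -> rep G x1 = rep G x2 ->
     exists s u v, [/\ rep G u = rep G x1, rep G v = rep G x1, u \in S s & v \notin S s]) ->
  (forall y1 y2, y1 != y2 -> rep H y1 = rep H y2 ->
     exists s u v, [/\ rep H u = rep H y1, rep H v = rep H y1, u \in T s & v \notin T s]) ->
  exists2 A : 'M[R]_(m + n), symmat (join G H) A & A *m A^T = 1%:M.
Proof.
move=> cG cH dS dT ST hB hG hH.
have [U1 [U1l U1r U1E]] := partial_isometry R (ST true).
have [U0 [U0l U0r U0E]] := partial_isometry R (ST false).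
pose col k (P : bool -> {set 'I_k}) x : R :=
  if x \in P true then 3 / 5 else if x \in P false then - (3 / 5) else 1.
have NS x : x \in S true -> x \in S false = false by apply: disjointFr.
have NT x : x \in T true -> x \in T false = false by apply: disjointFr.
have U1Z x y : ~~ ((x \in S true) && (y \in T true)) -> U1 x y = 0.
  by move=> N; apply/eqP/negPn; rewrite U1E.
have U0Z x y : ~~ ((x \in S false) && (y \in T false)) -> U0 x y = 0.
  by move=> N; apply/eqP/negPn; rewrite U0E.
pose a : 'rV[R]_m := \row_x col m S x.
pose b : 'rV[R]_n := \row_y - col n T y.
(* The pair 3/5, 4/5 is a rational point of the unit circle, so [B *m B^T] is 16/25 exactly where
   [a] squares to 9/25, and 0 where [a] is 1. *)
pose B : 'M[R]_(m, n) := (4 / 5) *: (U1 + U0).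
have UU0 : U1 *m U0^T = 0.
  apply/matrixP => x x'; rewrite !mxE big1 // => y _; rewrite !mxE.
  have [yT|yT] := boolP (y \in T true); last by rewrite U1Z ?mul0r // negb_and yT orbT.
  by rewrite U0Z ?mulr0 // negb_and NT ?orbT.
have U0U : U0 *m U1^T = 0 by rewrite -[LHS]trmxK trmx_mul trmxK UU0 trmx0.
have VV0 : U1^T *m U0 = 0.
  apply/matrixP => x x'; rewrite !mxE big1 // => y _; rewrite !mxE.
  have [yT|yT] := boolP (y \in S true); last by rewrite U1Z ?mul0r // negb_and yT.
  by rewrite U0Z ?mulr0 // negb_and NS.
have V0V : U0^T *m U1 = 0 by rewrite -[LHS]trmxK trmx_mul trmxK VV0 trmx0.
(* This identity and the next three are the blocks of [A *m A = 1%:M]. *)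
have BBT : B *m B^T = 1%:M - diag_mx a *m diag_mx a.
  rewrite /B [(_ *: _)^T]linearZ /= -scalemxAl -scalemxAr scalerA [(_ + _)^T]linearD /= mulmxDl !mulmxDr.
  rewrite U1l U0l UU0 U0U addr0 add0r mulmx_diag -diag_const_mx -linearB -linearD -linearZ /=.
  congr diag_mx; apply/rowP => x; rewrite !mxE /col.
  have [/NS->|_] := boolP (x \in S true); last case: (x \in S false); rewrite /=; lra.
have BTB : B^T *m B = 1%:M - diag_mx b *m diag_mx b.
  rewrite /B [(_ *: _)^T]linearZ /= -scalemxAl -scalemxAr scalerA [(_ + _)^T]linearD /= mulmxDl !mulmxDr.
  rewrite U1r U0r VV0 V0V addr0 add0r mulmx_diag -diag_const_mx -linearB -linearD -linearZ /=.
  congr diag_mx; apply/rowP => x; rewrite !mxE /col.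
  have [/NT->|_] := boolP (x \in T true); last case: (x \in T false); rewrite /=; lra.
have aBb : diag_mx a *m B + B *m diag_mx b = 0.
  apply/matrixP => x y; rewrite mul_diag_mx mul_mx_diag !mxE.
  rewrite [_ * - _]mulrN [(_ * _) * col n T y]mulrC -mulrBl /col.
  have [xS|xS] := boolP (x \in S true).
    have [yT|yT] := boolP (y \in T true); first by rewrite subrr mul0r.
    by rewrite U1Z ?U0Z ?addr0 ?mulr0 // negb_and ?yT ?orbT // NS.
  rewrite U1Z ?negb_and ?xS //.
  have [xS0|xS0] := boolP (x \in S false); last by rewrite U0Z ?addr0 ?mulr0 // negb_and xS0.
  have [yT|yT] := boolP (y \in T true); first by rewrite U0Z ?addr0 ?mulr0 // negb_and NT // orbT.
  have [yT0|yT0] := boolP (y \in T false); first by rewrite subrr mul0r.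
  by rewrite U0Z ?addr0 ?mulr0 // negb_and yT0 orbT.
have aBb' : B^T *m diag_mx a + diag_mx b *m B^T = 0.
  by rewrite -[LHS]trmxK linearD /= !trmx_mul !tr_diag_mx trmxK aBb trmx0.
have colE k (P : bool -> {set 'I_k}) s u v : (forall x, x \in P true -> x \in P false = false) ->
    u \in P s -> v \notin P s -> col k P u != col k P v.
  move=> NP; rewrite /col; case: s => [-> /negPf ->|uP /negPf vP].
    by case: ifP => _; [rewrite gt_eqF //; lra | rewrite lt_eqF //; lra].
  have -> : u \in P true = false by apply/negP => /NP; rewrite uP.
  by rewrite uP vP; case: ifP => _; rewrite lt_eqF //; lra.
have [||| Q QQ QA] := @join_realization R m n G H a b B cG cH.
- move=> x y; have [s [x' [y' [rx ry xS yT]]]] := hB x y.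
  exists x', y'; split => //; rewrite !mxE mulf_neq0 //; first by rewrite gt_eqF //; lra.
  case: s xS yT => xS yT.
    by rewrite [U0 _ _]U0Z ?negb_and ?NS // addr0 U1E xS.
  rewrite [U1 _ _]U1Z ?add0r ?U0E ?xS // negb_and.
  by apply/orP; left; apply/negP => /NS; rewrite xS.
- move=> x1 x2 x12 rx; have [s [u [v [ru rv us vs]]]] := hG x1 x2 x12 rx.
  by exists u, v; rewrite !mxE (colE _ _ s).
- move=> x1 x2 x12 rx; have [s [u [v [ru rv us vs]]]] := hH x1 x2 x12 rx.
  by exists u, v; rewrite !mxE eqr_opp (colE _ _ s).
set A := block_mx _ _ _ _ in QA.
have AA : A *m A = 1%:M.
  rewrite /A mulmx_block BBT BTB aBb aBb' [_ + (_ - _)]addrC !subrK.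
  by rewrite -scalar_mx_block.
exists (Q *m A *m Q^T) => //; case: QA => -> _.
have QTQ : Q^T *m Q = 1%:M by apply: mulmx1C.
by rewrite !mulmxA -[_ *m Q^T *m Q]mulmxA QTQ mulmx1 -[_ *m A *m A]mulmxA AA mulmx1.
Qed.

(** On the representatives [A] is the adjacency matrix of a complete bipartite graph with parts of
    sizes [k] and [l], whose eigenvalues lie among 0 and plus or minus [s], where [s] is the square
    root of [k * l]. The other vertices get the diagonal value [s], so no new eigenvalue appears
    while larger components are not monochromatic. *)
Lemma three_eigenvalues (R : realType) m n (G : sgraph m) (H : sgraph n) :
  (0 < m)%N -> (0 < n)%N -> complete_components G -> complete_components H ->
  exists2 A : 'M[R]_(m + n), symmat (join G H) A & (num_eigenvalues A <= 3)%N.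
Proof.
move=> m0 n0 cG cH.
pose k := #|reps G|; pose l := #|reps H|; pose s : R := Num.sqrt (k * l)%:R.
have k0 : (0 < k)%N by apply/card_gt0P; exists (rep G (Ordinal m0)); apply: rep_in_reps.
have l0 : (0 < l)%N by apply/card_gt0P; exists (rep H (Ordinal n0)); apply: rep_in_reps.
have s2 : s ^+ 2 = k%:R * l%:R by rewrite sqr_sqrtr ?ler0n // natrM.
have s0 : s != 0 by rewrite -sqrf_eq0 s2 mulf_neq0 ?pnatr_eq0 -?lt0n.
pose g : 'cV[R]_m := \col_x (x \in reps G)%:R.
pose h : 'cV[R]_n := \col_y (y \in reps H)%:R.
pose a : 'rV[R]_m := \row_x (s *+ (x \notin reps G)).
pose b : 'rV[R]_n := \row_y (s *+ (y \notin reps H)).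
have ind p (P : {set 'I_p}) : (\col_x (x \in P)%:R : 'cV[R]_p)^T *m \col_x (x \in P)%:R = (#|P|%:R)%:M.
  apply/matrixP => i j; rewrite !ord1 !mxE eqxx mulr1n.
  under eq_bigr do rewrite !mxE -natrM mulnb andbb.
  by rewrite -natr_sum -big_mkcond sum1_card.
have dg : diag_mx a *m g = 0.
  by apply/matrixP => x j; rewrite mul_diag_mx !mxE; case: (x \in reps G); rewrite /= ?mulr0 ?mul0r.
have dh : diag_mx b *m h = 0.
  by apply/matrixP => x j; rewrite mul_diag_mx !mxE; case: (x \in reps H); rewrite /= ?mulr0 ?mul0r.
have gd : g^T *m diag_mx a = 0 by rewrite -[LHS]trmxK trmx_mul trmxK tr_diag_mx dg trmx0.
have hd : h^T *m diag_mx b = 0 by rewrite -[LHS]trmxK trmx_mul trmxK tr_diag_mx dh trmx0.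
pose B := g *m h^T.
have BT : B^T = h *m g^T by rewrite trmx_mul trmxK.
have [||| Q QQ QA] := @join_realization R m n G H a b B cG cH.
- move=> x y; exists (rep G x), (rep H y); rewrite !rep_rep; split=> //.
  by rewrite mxE big_ord1 !mxE !rep_in_reps mulr1 oner_eq0.
- move=> x1 x2 x12 rx; have [u [ru uR]] := nonrep_exists x12 rx.
  by exists u, (rep G x1); rewrite ru rep_rep !mxE uR rep_in_reps /= mulr1n mulr0n.
- move=> x1 x2 x12 rx; have [u [ru uR]] := nonrep_exists x12 rx.
  by exists u, (rep H x1); rewrite ru rep_rep !mxE uR rep_in_reps /= mulr1n mulr0n.
set A := block_mx _ _ _ _ in QA.
have a3 : diag_mx a *m diag_mx a *m diag_mx a = s ^+ 2 *: diag_mx a.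
  rewrite !mulmx_diag -linearZ /=; congr diag_mx; apply/matrixP => i x; rewrite !mxE.
  by case: (x \in reps G); rewrite /= ?mulr0n ?mulr1n; ring.
have b3 : diag_mx b *m diag_mx b *m diag_mx b = s ^+ 2 *: diag_mx b.
  rewrite !mulmx_diag -linearZ /=; congr diag_mx; apply/matrixP => i x; rewrite !mxE.
  by case: (x \in reps H); rewrite /= ?mulr0n ?mulr1n; ring.
have A2 : A *m A = block_mx (diag_mx a *m diag_mx a + l%:R *: (g *m g^T)) 0 0
                            (diag_mx b *m diag_mx b + k%:R *: (h *m h^T)).
  rewrite /A mulmx_block BT /B; congr block_mx.
  - by rewrite -!mulmxA [h^T *m (h *m _)]mulmxA ind mul_scalar_mx -scalemxAr.
  - by rewrite mulmxA dg mul0mx -mulmxA hd mulmx0 addr0.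
  - by rewrite mulmxA dh mul0mx -mulmxA gd mulmx0 addr0.
  - by rewrite addrC -!mulmxA [g^T *m (g *m _)]mulmxA ind mul_scalar_mx -scalemxAr.
have A3 : A *m A *m A = s ^+ 2 *: A.
  rewrite A2 /A mulmx_block scale_block_mx !mul0mx !addr0 !add0r !mulmxDl a3 b3 BT /B.
  rewrite -!scalemxAl -!mulmxA gd hd (mulmxA _ g) dg (mulmxA _ h) dh.
  rewrite !(mulmx0, mul0mx, scaler0, addr0, add0r).
  rewrite [g^T *m (g *m _)]mulmxA [h^T *m (h *m _)]mulmxA !ind !mul_scalar_mx.
  by rewrite -!scalemxAr !scalerA s2 [l%:R * k%:R]mulrC.
exists (Q *m A *m Q^T) => //.
have QTQ : Q^T *m Q = 1%:M by apply: mulmx1C.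
apply: (@cubic_num_eigenvalues R _ _ s).
rewrite scalemxAl scalemxAr -A3 !mulmxA.
by rewrite -[_ *m Q^T *m Q]mulmxA QTQ mulmx1 -[_ *m Q^T *m Q]mulmxA QTQ mulmx1.
Qed.

(** * Existence of colourings *)

(** All representatives of [H] are coupled to equally many vertices of [G], among them all
    representatives, chosen outside [E] so that each larger component keeps an uncoloured vertex.
    The complement of [E] has [m - (k - |iso G|)] vertices, at least [l] by hypothesis. *)
Lemma one_color (R : realType) m n (G : sgraph m) (H : sgraph n) :
  complete_components G -> complete_components H ->
  (#|components G| <= #|components H|)%N ->
  (#|components G| + #|components H| <= m + #|iso G|)%N ->
  exists2 A : 'M[R]_(m + n), symmat (join G H) A & A *m A^T = 1%:M.
Proof.
move=> cG cH kl klm.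
have [E dE [cE EP]] := second_vertices G.
have [|| S [RS SE cS]] := @subset_card_between _ (reps G) (~: E) #|reps H|.
- by rewrite -finset.disjoints_subset.
- have := cardsC E; rewrite -!card_components kl cE card_noniso card_ord.
  by have := subset_leq_card (iso_reps G); rewrite -card_components; lia.
pose SS s := if s then S else finset.set0; pose TT s := if s then reps H else finset.set0.
apply: (@coloring_orthogonal R m n G H SS TT) => //.
- by rewrite disjoint_sym finset.disjoints_subset finset.sub0set.
- by rewrite disjoint_sym finset.disjoints_subset finset.sub0set.
- by case; rewrite /= ?finset.cards0.
- move=> x y; exists true, (rep G x), (rep H y); rewrite !rep_rep rep_in_reps.
  by rewrite (fintype.subsetP RS) ?rep_in_reps.
- move=> x1 x2 x12 rx; have [e eE [re _]] := EP _ (nontrivial_rep x12 rx).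
  exists true, (rep G x1), e; rewrite rep_rep re (fintype.subsetP RS) ?rep_in_reps //; split=> //.
  by apply/negP => /(fintype.subsetP SE); rewrite finset.inE eE.
- move=> y1 y2 y12 ry; have [u [ru uR]] := nonrep_exists y12 ry.
  by exists true, (rep H y1), u; rewrite rep_rep rep_in_reps.
Qed.

(** Each component of [G] has two vertices and receives both colours, one on its representative and
    one in [E]. A component of [H] then needs only one coloured vertex to be coupled to every
    component of [G]. *)
Lemma two_colors (R : realType) m n (G : sgraph m) (H : sgraph n) :
  complete_components G -> complete_components H ->
  iso G = finset.set0 -> (#|components H| <= m)%N -> (2 * #|components G| <= n)%N ->
  exists2 A : 'M[R]_(m + n), symmat (join G H) A & A *m A^T = 1%:M.
Proof.
move=> cG cH iG lm kn.
set k := #|components G| in kn *; set l := #|components H| in lm.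
have [E dE [cE EP]] := second_vertices G.
have {}EP x : exists2 e, e \in E & rep G e = rep G x.
  have [|e eE [re _]] := EP (rep G x); last by exists e.
  by rewrite iG finset.setD0 rep_in_reps.
have {}cE : #|E| = k by rewrite cE card_noniso iG finset.cards0 subn0.
have km : (2 * k <= m)%N.
  have := max_card (mem (reps G :|: E)).
  by rewrite cardsU finset.disjoint_setI0 // finset.cards0 cE card_ord -card_components -/k; lia.
have ln : (l <= n)%N by rewrite /l card_components -[n in (_ <= n)%N]card_ord max_card.
(* The number of coloured vertices on each side: enough for all representatives of [H] and for [k]
   vertices of each colour in [G], yet at most [m] and [n]. *)
pose c := maxn (2 * k) l.
have [|| T0 [RT _ cT]] := @subset_card_between _ (reps H) [set: 'I_n] c.
- exact: finset.subsetT.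
- by rewrite finset.cardsT card_ord -card_components -/l /c; lia.
have [U UT [cU UP]] := split_fibers (rep H) T0.
have [|| S1 [RS1 S1E cS1]] := @subset_card_between _ (reps G) (~: E) c./2.
- by rewrite -finset.disjoints_subset.
- by have := cardsC E; rewrite -card_components -/k cE card_ord /c; lia.
have [|| S2 [ES2 S2S cS2]] := @subset_card_between _ E (~: S1) (c - c./2).
- by rewrite finset.subsetC.
- by have := cardsC S1; rewrite cE cS1 card_ord /c; lia.
pose SS (s : bool) := if s then S1 else S2; pose TT (s : bool) := if s then U else T0 :\: U.
have rT y : exists s, rep H y \in TT s.
  exists (rep H y \in U); rewrite /TT; case: ifP => // yU.
  by rewrite !finset.inE yU (fintype.subsetP RT) ?rep_in_reps.
apply: (@coloring_orthogonal R m n G H SS TT) => //.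
- by rewrite disjoint_sym finset.disjoints_subset.
- by rewrite finset.disjoints_subset /=; apply/fintype.subsetP => y yU; rewrite !finset.inE yU.
- case; rewrite /= ?cS1 ?cU ?cT // cardsD (finset.setIidPr UT) cU cT cS2 //.
- move=> x y; have [s ys] := rT y; case: s ys => ys.
    exists true, (rep G x), (rep H y); rewrite !rep_rep; split=> //.
    by rewrite (fintype.subsetP RS1) ?rep_in_reps.
  have [e eE re] := EP x.
  exists false, e, (rep H y); rewrite rep_rep; split=> //.
  exact: (fintype.subsetP ES2).
- move=> x1 x2 x12 rx; have [e eE re] := EP x1.
  exists true, (rep G x1), e; rewrite rep_rep /= (fintype.subsetP RS1) ?rep_in_reps //; split=> //.
  by apply/negP => /(fintype.subsetP S1E); rewrite finset.inE eE.
- move=> y1 y2 y12 ry.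
  (* A component leaving [T0] has an uncoloured vertex besides its coloured representative; one with
     two vertices in [T0] sees both colours by [split_fibers]. *)
  have outside z : rep H z = rep H y1 -> z \notin T0 -> exists s u v,
      [/\ rep H u = rep H y1, rep H v = rep H y1, u \in TT s & v \notin TT s].
    move=> rz zT; have [s ys] := rT y1; exists s, (rep H y1), z; rewrite rep_rep; split=> //.
    apply: contra zT; case: (s) => [/(fintype.subsetP UT)|] //.
    by rewrite finset.inE => /andP[].
  have [y1T|] := boolP (y1 \in T0); last exact: outside.
  have [y2T|] := boolP (y2 \in T0); last exact: outside.
  have [u [v [uU vU ru rv]]] := UP y1 y2 y1T y2T y12 ry.
  exists true, u, v; split=> //; by move: vU; rewrite finset.inE => /andP[].
Qed.

(** If one colour does not suffice, failure of (b) leaves [iso G] empty. Then [n < 2k] would give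
    (c): [2k <= m < k + l] yields [k < l], [l <= n] yields [l < 2k], and an [H] without isolated
    vertices would have [2l <= n]. Hence two colours suffice. *)
Lemma complete_orthogonal (R : realType) m n (G : sgraph m) (H : sgraph n) :
  complete_components G -> complete_components H ->
  (#|components G| <= #|components H|)%N ->
  ~ (condA G H \/ condB G H \/ condC G H) ->
  exists2 A : 'M[R]_(m + n), symmat (join G H) A & A *m A^T = 1%:M.
Proof.
move=> cG cH kl N.
have lm : (#|components H| <= m)%N by rewrite leqNgt; apply/negP => ?; apply: N; left.
have [klm|klm] := leqP (#|components G| + #|components H|) (m + #|iso G|).
  exact: one_color.
have iG : iso G = finset.set0.
  by apply/eqP/negPn/negP => iG; apply: N; right; left; rewrite /condB iG.
apply: two_colors => //; rewrite leqNgt; apply/negP => nk.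
rewrite iG finset.cards0 addn0 in klm.
have twice p (K : sgraph p) : iso K = finset.set0 -> (2 * #|components K| <= p)%N.
  move=> iK; have [E dE [cE _]] := second_vertices K.
  have := max_card (mem (reps K :|: E)).
  rewrite cardsU finset.disjoint_setI0 // finset.cards0 cE card_ord card_noniso iK finset.cards0.
  by rewrite -card_components; lia.
have ln : (#|components H| <= n)%N by rewrite card_components -[n in (_ <= n)%N]card_ord max_card.
have km := twice _ _ iG.
have iH : iso H != finset.set0 by apply/eqP => /twice; lia.
apply: N; right; right; rewrite /condC iG eqxx iH nk klm !andbT /=.
move: km ln nk klm lm; move: #|components G| #|components H| => k l.
by lia.
Qed.

(** * Obstructions *)

Lemma mul_row_tr_eq0 (R : realFieldType) p (v : 'rV[R]_p) : v *m v^T = 0 -> v = 0.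
Proof.
move=> /matrixP/(_ 0 0); rewrite !mxE => /eqP.
rewrite psumr_eq0 => [|x _]; last by rewrite mxE -expr2 sqr_ge0.
move=> /allP v0; apply/rowP => x; rewrite mxE; apply/eqP.
by have /implyP/(_ isT) := v0 x (mem_index_enum x); rewrite mxE mulf_eq0 orbb.
Qed.

(** Pairwise orthogonal nonzero vectors are independent. Each dimension count below is an instance
    of this. *)
Lemma orthogonal_rows_rank (R : realFieldType) (I : finType) (S : {set I}) p q
    (v : I -> 'rV[R]_p) (W : 'M[R]_(q, p)) :
  (forall i, i \in S -> (v i <= W)%MS) -> (forall i, i \in S -> v i != 0) ->
  (forall i j, i \in S -> j \in S -> i != j -> v i *m (v j)^T = 0) ->
  (#|S| <= \rank W)%N.
Proof.
move=> vW v0 vv; pose M := \matrix_(i < #|S|) v (enum_val i).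
have MW : (M <= W)%MS by apply/row_subP => i; rewrite rowK vW ?enum_valP.
apply: leq_trans (mxrankS MW); rewrite row_leq_rank; apply: inj_row_free => u uM.
apply/rowP => j; rewrite mxE; apply/eqP.
have : (u 0 j *: (v (enum_val j) *m (v (enum_val j))^T)) = 0.
  have := congr1 (mulmx^~ (v (enum_val j))^T) uM; rewrite mul0mx => <-.
  rewrite [u *m M]mulmx_sum_row mulmx_suml (bigD1 j) //= big1 ?addr0; last first.
    move=> i ij; rewrite rowK -scalemxAl vv ?enum_valP ?scaler0 //.
    by rewrite (inj_eq enum_val_inj).
  by rewrite rowK -scalemxAl.
move=> /eqP; rewrite scaler_eq0 => /orP[//|/eqP/mul_row_tr_eq0 E].
by have := v0 _ (enum_valP j); rewrite E eqxx.
Qed.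

(** * Block structure along the components *)

Definition blockdiag (R : pzRingType) p (K : sgraph p) (Z : 'M[R]_p) :=
  forall x y, rep K x != rep K y -> Z x y = 0.

(** The coordinate projection onto the component represented by [i]; it is zero when [i] is not a
    representative. *)
Definition comp_mx (R : pzRingType) p (K : sgraph p) (i : 'I_p) : 'M[R]_p :=
  diag_mx (\row_x (rep K x == i)%:R).
Arguments comp_mx {R p} K i.

Lemma tr_comp_mx (R : pzRingType) p (K : sgraph p) i :
  (comp_mx K i)^T = comp_mx K i :> 'M[R]_p.
Proof. exact: tr_diag_mx. Qed.

Lemma mul_comp_mxE (R : pzRingType) p (K : sgraph p) (v : 'rV[R]_p) i x :
  (v *m comp_mx K i) 0 x = v 0 x *+ (rep K x == i).
Proof. by rewrite mul_mx_diag !mxE mulr_natr. Qed.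

Lemma comp_mxC (R : comPzRingType) p (K : sgraph p) (Z : 'M[R]_p) i : blockdiag K Z ->
  comp_mx K i *m Z = Z *m comp_mx K i.
Proof.
move=> bZ; apply/matrixP => x y; rewrite mul_diag_mx mul_mx_diag !mxE.
have [->|/bZ ->] := eqVneq (rep K x) (rep K y); first by rewrite mulrC.
by rewrite mulr0 mul0r.
Qed.

Lemma comp_mxD (R : comPzRingType) p (K : sgraph p) i j : i != j ->
  comp_mx K i *m comp_mx K j = 0 :> 'M[R]_p.
Proof.
move=> ij; rewrite mulmx_diag; apply/matrixP => x y; rewrite !mxE -natrM mulnb.
by case: eqP => [->|_]; rewrite ?(negPf ij) mul0rn.
Qed.

Lemma comp_mx_idem (R : comPzRingType) p (K : sgraph p) i :
  comp_mx K i *m comp_mx K i = comp_mx K i :> 'M[R]_p.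
Proof.
by rewrite mulmx_diag; congr diag_mx; apply/rowP => x; rewrite !mxE -natrM mulnb andbb.
Qed.

(** [Z] commutes with the projections, and those of distinct components multiply to 0. Taking for
    [Z] a Gram matrix such as [B *m B^T], this makes the images under [B] of vectors from distinct
    components orthogonal. *)
Lemma comp_mx_orthogonal (R : comPzRingType) p (K : sgraph p) (Z : 'M[R]_p) i j u v :
  blockdiag K Z -> i != j -> u *m comp_mx K i = u -> v *m comp_mx K j = v ->
  u *m Z *m v^T = 0 :> 'M[R]_1.
Proof.
move=> bZ ij <- <-; rewrite trmx_mul tr_comp_mx.
rewrite -[u *m _ *m Z]mulmxA comp_mxC // !mulmxA -[_ *m comp_mx K i *m comp_mx K j]mulmxA.
by rewrite comp_mxD // mulmx0 mul0mx.
Qed.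

Lemma mul_comp_mx_neq0 (R : pzRingType) p (K : sgraph p) (v : 'rV[R]_p) i :
  (forall x, v 0 x != 0) -> i \in reps K -> v *m comp_mx K i != 0.
Proof.
move=> v0 iR; apply/eqP => /rowP/(_ i)/eqP.
by rewrite mul_comp_mxE reps_rep // eqxx mxE (negPf (v0 i)).
Qed.

(* Symmetric in G and H: see orth_blocks_swap. *)
Record orth_blocks (R : realType) m n (G : sgraph m) (H : sgraph n)
    (X : 'M[R]_m) (B : 'M[R]_(m, n)) (Y : 'M[R]_n) : Prop := OrthBlocks {
  ob_XT : X^T = X;
  ob_YT : Y^T = Y;
  ob_XE : forall i j, i != j -> (X i j != 0) = G i j;
  ob_YE : forall i j, i != j -> (Y i j != 0) = H i j;
  ob_B : forall i j, B i j != 0;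
  ob_BBT : B *m B^T = 1%:M - X *m X;
  ob_BTB : B^T *m B = 1%:M - Y *m Y;
  ob_XB : X *m B = - (B *m Y)
}.

Lemma orth_blocks_swap (R : realType) m n (G : sgraph m) (H : sgraph n) (X : 'M[R]_m) B Y :
  orth_blocks G H X B Y -> orth_blocks H G Y B^T X.
Proof.
move=> [XT YT XE YE B0 BBT BTB XB]; split=> //.
- by move=> i j; rewrite mxE.
- by rewrite trmxK.
- by rewrite trmxK.
- by rewrite -{1}YT -trmx_mul -[B *m Y]opprK -XB linearN /= trmx_mul XT.
Qed.

Lemma orth_blocksP (R : realType) m n (G : sgraph m) (H : sgraph n) (A : 'M[R]_(m + n)) :
  symmat (join G H) A -> A *m A^T = 1%:M ->
  orth_blocks G H (ulsubmx A) (ursubmx A) (drsubmx A).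
Proof.
move=> [As AE] AA.
have dl : dlsubmx A = (ursubmx A)^T by rewrite trmx_ursub As.
have AAs : A *m A = 1%:M by rewrite -{2}As.
have := AAs; rewrite -{1 2}(submxK A) dl mulmx_block scalar_mx_block.
move=> /eq_block_mx[E1 E2 _ E4].
have XT : (ulsubmx A)^T = ulsubmx A by rewrite trmx_ulsub As.
have YT : (drsubmx A)^T = drsubmx A by rewrite trmx_drsub As.
split=> //.
- move=> i j ij; rewrite !mxE AE ?(inj_eq (@lshift_inj _ _)) //=.
  by rewrite join_edgeE.
- move=> i j ij; rewrite !mxE AE ?(inj_eq (@rshift_inj _ _)) //=.
  by rewrite join_edgeE.
- by move=> i j; rewrite !mxE AE ?eq_lrshift //= join_edgeE.
- by rewrite -E1 addrC addKr.
- by rewrite -E4 addrK.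
- by apply/eqP; rewrite -addr_eq0 E2.
Qed.

Lemma ob_blockdiag (R : realType) m n (G : sgraph m) (H : sgraph n) (X : 'M[R]_m) B Y :
  orth_blocks G H X B Y -> blockdiag G X.
Proof.
move=> ob x y rxy; apply/eqP; rewrite -[_ == 0]negbK (ob_XE ob).
  by apply: contra rxy => /edge_rep ->.
by apply: contraNneq rxy => ->.
Qed.

Lemma ob_blockdiag_sqr (R : realType) m n (G : sgraph m) (H : sgraph n) (X : 'M[R]_m) B Y :
  orth_blocks G H X B Y -> blockdiag G (1%:M - X *m X).
Proof.
move=> ob x y rxy; have bX := ob_blockdiag ob.
have xy : x != y by apply: contraNneq rxy => ->.
rewrite !mxE (negPf xy) sub0r big1 ?oppr0 // => z _.
have [rz|/bX ->] := eqVneq (rep G x) (rep G z); last by rewrite mul0r.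
by rewrite [X z y]bX ?mulr0 // -rz.
Qed.

(** Excludes (a): the columns of [B] at the representatives of [H] are nonzero vectors of length
    [m], and their inner products are entries of the block diagonal [1%:M - Y *m Y] between
    different components. *)
Lemma ob_components_le (R : realType) m n (G : sgraph m) (H : sgraph n) (X : 'M[R]_m) B Y :
  (0 < m)%N -> orth_blocks G H X B Y -> (#|components H| <= m)%N.
Proof.
move=> m0 ob; rewrite card_components -(mxrank1 R m).
apply: (@orthogonal_rows_rank R _ _ _ _ (fun i => row i B^T)).
- by move=> i _; apply: submx1.
- move=> i _; apply/eqP => /rowP/(_ (Ordinal m0))/eqP.
  by rewrite !mxE (negPf (ob_B ob _ _)).
- move=> i j iR jR ij; apply/matrixP => u v.
  have -> : (row i B^T *m (row j B^T)^T) u v = (B^T *m B) i j.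
    by rewrite !mxE; apply: eq_bigr => k _; rewrite !mxE.
  by rewrite (ob_BTB ob) (ob_blockdiag_sqr (orth_blocks_swap ob)) ?mxE // !reps_rep.
Qed.

(** The rows of [X - a%:M] at non-isolated representatives are nonzero, by an edge, and have
    disjoint supports. So no eigenspace of [X] exceeds dimension [m - (k - |iso G|)]. *)
Lemma ob_noniso_rank (R : realType) m n (G : sgraph m) (H : sgraph n) (X : 'M[R]_m) B Y a :
  orth_blocks G H X B Y -> (#|components G| - #|iso G| <= \rank (X - a%:M)%R)%N.
Proof.
move=> ob; rewrite -card_noniso.
apply: (@orthogonal_rows_rank R _ _ _ _ (fun i => row i (X - a%:M))).
- by move=> i _; apply: row_sub.
- move=> i; rewrite finset.inE => /andP[/noniso_edge[j Gij] _].
  have ij : i != j by apply: contraTneq Gij => ->; rewrite edge_irr.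
  apply/eqP => /rowP/(_ j)/eqP; rewrite !mxE (negPf ij) mulr0n subr0.
  by apply/negP; rewrite (ob_XE ob).
- move=> i j; rewrite !finset.inE => /andP[_ /eqP iR] /andP[_ /eqP jR] ij.
  apply/matrixP => u v; rewrite !mxE big1 // => z _; rewrite !mxE.
  have bX := ob_blockdiag ob.
  have bZ x : rep G x = x -> rep G x != rep G z -> X x z - a *+ (x == z) = 0.
    move=> xR xz; rewrite bX // (_ : (x == z) = false) ?mulr0n ?subr0 //.
    by apply: contraNF xz => /eqP ->.
  have [iz|/(bZ _ iR) ->] := eqVneq (rep G i) (rep G z); last by rewrite mul0r.
  by rewrite [X in _ * X]bZ ?mulr0 // -iz iR jR eq_sym.
Qed.

(** Multiplication by [B^T] carries the [z i] into the eigenspace of [X] for [a]. Since [B^T *m B]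
    acts on [z i] as [1 - a ^+ 2], which is nonzero, the images are nonzero; they are orthogonal
    because the supports lie in distinct components. So [l] is at most the dimension of that
    eigenspace, bounded by [ob_noniso_rank]. *)
Lemma ob_transfer (R : realType) m n (G : sgraph m) (H : sgraph n) (X : 'M[R]_m) B Y
    (a : R) (z : 'I_n -> 'rV[R]_n) :
  orth_blocks G H X B Y -> 1 - a ^+ 2 != 0 ->
  (forall i, i \in reps H ->
     [/\ z i *m comp_mx H i = z i, z i != 0 & z i *m Y = - a *: z i]) ->
  (#|components H| + #|components G| <= m + #|iso G|)%N.
Proof.
move=> ob a1 zP; have ob' := orth_blocks_swap ob.
have BTX : B^T *m X = - (Y *m B^T) by rewrite (ob_XB ob') opprK.
have zYY i : i \in reps H -> z i *m (1%:M - Y *m Y) = (1 - a ^+ 2) *: z i.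
  move=> /zP[_ _ zY]; rewrite mulmxBr mulmx1 mulmxA zY -scalemxAl zY scalerA mulrNN -expr2.
  by rewrite scalerBl scale1r.
have : (#|reps H| <= \rank (kermx (X - a%:M)%R))%N.
  apply: (@orthogonal_rows_rank R _ _ _ _ (fun i => z i *m B^T)).
  - move=> i iR; apply/sub_kermxP; have [_ _ zY] := zP i iR.
    rewrite mulmxBr -mulmxA BTX mulmxN mulmxA zY -scalemxAl mul_mx_scalar.
    by rewrite scaleNr opprK subrr.
  - move=> i iR; have [_ z0 _] := zP i iR; apply: contraNneq z0 => zB.
    apply/eqP/mul_row_tr_eq0; apply/eqP; have := zYY i iR.
    rewrite -(ob_BTB ob) mulmxA zB mul0mx => /esym/eqP.
    by rewrite scaler_eq0 (negPf a1) /= => /eqP ->; rewrite mul0mx.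
  - move=> i j iR jR ij; rewrite trmx_mul trmxK mulmxA -[_ *m B^T *m B]mulmxA (ob_BTB ob).
    have [zi _ _] := zP i iR; have [zj _ _] := zP j jR.
    exact: (comp_mx_orthogonal (ob_blockdiag_sqr ob') ij zi zj).
rewrite mxrank_ker -card_components; have := ob_noniso_rank a ob.
have := rank_leq_row (X - a%:M).
move: (\rank _) #|components _| #|components _| #|iso _| => r l k c; lia.
Qed.

(** Row [x] of [X] is supported at [x], so row [x] of [X *m B = - (B *m Y)] is an eigenvector
    equation. The squared norm of that row of [B] is [1 - X x x ^+ 2], nonzero because [B] has no
    zero entry. *)
Lemma ob_iso_row (R : realType) m n (G : sgraph m) (H : sgraph n) (X : 'M[R]_m) B Y x :
  (0 < n)%N -> orth_blocks G H X B Y -> x \in iso G ->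
  1 - X x x ^+ 2 != 0 /\ row x B *m Y = - X x x *: row x B.
Proof.
move=> n0 ob; rewrite finset.inE => /forallP xI.
have Xx y : x != y -> X x y = 0.
  by move=> xy; apply/eqP; rewrite -[_ == 0]negbK (ob_XE ob).
have rX : row x X = X x x *: delta_mx 0 x.
  apply/rowP => y; rewrite !mxE eqxx; have [<-|xy] := eqVneq x y.
    by rewrite mulr1.
  by rewrite Xx // mulr0.
split; last first.
  rewrite -row_mul -[B *m Y]opprK -(ob_XB ob) -[X in row x X]mulNmx row_mul.
  by rewrite [row x (- X)]linearN /= rX mulNmx -scalemxAl -rowE scaleNr.
have -> : 1 - X x x ^+ 2 = (row x B *m (row x B)^T) 0 0.
  transitivity ((B *m B^T) x x); last first.
    by rewrite !mxE; apply: eq_bigr => y _; rewrite !mxE.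
  have XX : (X *m X) x x = X x x ^+ 2.
    rewrite mxE (bigD1 x) //= big1 ?addr0 // => y yx.
    by rewrite Xx ?mul0r // eq_sym.
  by rewrite (ob_BBT ob) -XX !mxE eqxx mulr1n.
apply/eqP => E; have /rowP/(_ (Ordinal n0))/eqP : row x B = 0.
  by apply: mul_row_tr_eq0; apply/matrixP => i j; rewrite !ord1 E mxE.
by rewrite !mxE (negPf (ob_B ob _ _)).
Qed.

(** The isolated vertex gives a nowhere zero eigenvector [c] of [X] for [a]. If each component of
    [H] carries an eigenvector of [Y] for [- a], [ob_transfer] gives the first bound. Otherwise some
    component [j] carries none, and the pieces of [c] and of column [j] of [B] along the components
    of [G] have [2k] nonzero, pairwise orthogonal images under [B]. *)
Lemma ob_iso_dichotomy (R : realType) m n (G : sgraph m) (H : sgraph n) (X : 'M[R]_m) B Y y :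
  (0 < m)%N -> orth_blocks G H X B Y -> iso G = finset.set0 -> y \in iso H ->
  (#|components H| + #|components G| <= m)%N \/ (2 * #|components G| <= n)%N.
Proof.
move=> m0 ob iG yI; have ob' := orth_blocks_swap ob.
have [a1 cX] := ob_iso_row m0 ob' yI.
set c := row y B^T in cX; set a := - Y y y in cX.
have {}a1 : 1 - a ^+ 2 != 0 by rewrite sqrrN.
pose P j (u : 'rV[R]_n) := [/\ u *m comp_mx H j = u, u != 0 & u *m Y = - a *: u].
have [PE|] := pselect (forall j, exists u, j \in reps H -> P j u).
  have [z zP] := boolp.choice PE; left.
  by have := ob_transfer ob a1 zP; rewrite iG finset.cards0 addn0.
move=> /existsNP[j /forallNP Pj]; right.
(* For a [j] that is not a representative, the failing statement would hold vacuously. *)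
have jR : j \in reps H by apply/negPn/negP => jR; apply: (Pj 0) => /(negP jR).
have bX := ob_blockdiag ob; have bY := ob_blockdiag ob'.
have cDX i : c *m comp_mx G i *m X = a *: (c *m comp_mx G i).
  by rewrite -mulmxA comp_mxC // mulmxA cX scalemxAl.
(* If nonzero, this vector would be an eigenvector of [Y] for [- a] supported on component [j]. *)
have cDB i : c *m comp_mx G i *m B *m comp_mx H j = 0.
  apply/eqP/negPn/negP => u0; apply: (Pj (c *m comp_mx G i *m B *m comp_mx H j)) => _.
  split=> //; first by rewrite -[LHS]mulmxA comp_mx_idem.
  rewrite -[LHS]mulmxA comp_mxC // mulmxA -[_ *m B *m Y]mulmxA.
  by rewrite -[B *m Y]opprK -(ob_XB ob) mulmxN mulmxA cDX mulNmx -!scalemxAl -scaleNr.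
pose g := row j B^T.
(* Coordinate [j] of the vanishing vector in [cDB] is precisely this inner product with column [j]
   of [B]. *)
have cg i : c *m comp_mx G i *m (g *m comp_mx G i)^T = 0.
  rewrite trmx_mul tr_comp_mx mulmxA -[_ *m comp_mx G i *m comp_mx G i]mulmxA comp_mx_idem.
  rewrite tr_row trmxK; apply/matrixP => u v; rewrite !ord1 colE mulmxA -colE [LHS]mxE.
  have /rowP/(_ j) := cDB i; rewrite mul_comp_mxE reps_rep // eqxx mulr1n => ->.
  by rewrite !mxE.
pose v (bi : bool * 'I_m) := (if bi.1 then c else g) *m comp_mx G bi.2.
have cBB i : v (true, i) *m (1%:M - X *m X) = (1 - a ^+ 2) *: v (true, i).
  rewrite /v /= mulmxBr mulmx1 mulmxA cDX -scalemxAl cDX scalerA -expr2.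
  by rewrite scalerBl scale1r.
have vv p r : v p *m B *m (v r *m B)^T = v p *m (1%:M - X *m X) *m (v r)^T.
  by rewrite trmx_mul mulmxA -[_ *m B *m B^T]mulmxA (ob_BBT ob).
(* A piece of [c] is an eigenvector of [B *m B^T], so its orthogonality to the piece of [g] survives
   multiplication by [B]. *)
have tf i : v (true, i) *m B *m (v (false, i) *m B)^T = 0.
  by rewrite vv cBB -scalemxAl cg scaler0.
have : (#|finset.setX [set: bool] (reps G)| <= \rank (1%:M : 'M[R]_n))%N.
  apply: (@orthogonal_rows_rank R _ _ _ _ (fun bi => v bi *m B)).
  - by move=> i _; apply: submx1.
  - move=> [[] i]; rewrite finset.in_setX /= => /andP[_ iR].
      have v0 : v (true, i) != 0 by apply: mul_comp_mx_neq0 => // x; rewrite !mxE (ob_B ob).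
      apply: contraNneq v0 => vB; apply/eqP/mul_row_tr_eq0; apply/eqP.
      have := cBB i; rewrite -(ob_BBT ob) mulmxA vB mul0mx => /esym/eqP.
      by rewrite scaler_eq0 (negPf a1) /= => /eqP ->; rewrite mul0mx.
    (* Coordinate [j] of the image of a piece of [g] is a sum of squares of entries of column [j] of
       [B], with a nonzero term at [x = i]. *)
    apply/eqP => /rowP/(_ j); rewrite [LHS]mxE [RHS]mxE => /eqP.
    rewrite psumr_eq0 => [/allP/(_ i (mem_index_enum i))|x _].
      by rewrite mul_comp_mxE reps_rep // eqxx mulr1n !mxE mulf_eq0 orbb (negPf (ob_B ob _ _)).
    rewrite mul_comp_mxE !mxE mulrnAl; apply: mulrn_wge0; exact: sqr_ge0.
  - move=> [b1 i1] [b2 i2] _ _ ne.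
    have vi b i : v (b, i) *m comp_mx G i = v (b, i) by rewrite /v -mulmxA comp_mx_idem.
    have [i12|i12] := eqVneq i1 i2; last first.
      rewrite vv; exact: (comp_mx_orthogonal (ob_blockdiag_sqr ob) i12 (vi _ _) (vi _ _)).
    move: ne; rewrite i12; case: b1; case: b2; rewrite ?eqxx // => _.
    by rewrite -[LHS]trmxK trmx_mul trmxK tf trmx0.
by rewrite mxrank1 cardsX finset.cardsT card_bool card_components.
Qed.

Lemma cond_no_orthogonal (R : realType) m n (G : sgraph m) (H : sgraph n) :
  (0 < m)%N -> (0 < n)%N -> condA G H \/ condB G H \/ condC G H ->
  ~ exists2 A : 'M[R]_(m + n), symmat (join G H) A & A *m A^T = 1%:M.
Proof.
move=> m0 n0 C [A AS AA]; have ob := orth_blocksP AS AA.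
case: C => [lt_ml|[/andP[iG lt]|/and5P[/eqP iG iH _ lt_n lt_m]]].
- by have := ob_components_le m0 ob; rewrite leqNgt => /negP.
- have [x xI] := finset.set0Pn _ iG.
  have [a1 bY] := ob_iso_row n0 ob xI.
  have b0 y : row x (ursubmx A) 0 y != 0 by rewrite mxE (ob_B ob).
  have : (#|components H| + #|components G| <= m + #|iso G|)%N.
    (* The row of [B] at the isolated vertex is a nowhere zero eigenvector of [Y]; since [Y] is
       block diagonal, its restriction to each component of [H] is again an eigenvector. *)
    apply: (ob_transfer ob a1 (z := fun i => row x (ursubmx A) *m comp_mx H i)) => i iR.
    have bY' := ob_blockdiag (orth_blocks_swap ob).
    split; first by rewrite -mulmxA comp_mx_idem.
      exact: mul_comp_mx_neq0.
    by rewrite -mulmxA comp_mxC // mulmxA bY scalemxAl.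
  by rewrite addnC leqNgt lt.
- have [y yI] := finset.set0Pn _ iH.
  have [|] := ob_iso_dichotomy m0 ob iG yI; first by rewrite addnC leqNgt lt_m.
  by rewrite leqNgt lt_n.
Qed.

(** * The values of [q] *)

Lemma q_attained (R : realType) n (K : sgraph n) :
  exists2 A : 'M[R]_n, symmat K A & num_eigenvalues A = q R K.
Proof. by rewrite /q; case: ex_minnP => k /asboolP. Qed.

Lemma q_le (R : realType) n (K : sgraph n) (A : 'M[R]_n) :
  symmat K A -> (q R K <= num_eigenvalues A)%N.
Proof.
move=> AK; rewrite /q; case: ex_minnP => k _; apply.
by apply/asboolP; exists A.
Qed.

Theorem theorem1p1 (R : realType) (m n : nat) (G : sgraph m) (H : sgraph n)
    (m_gt0 : (0 < m)%N) (n_gt0 : (0 < n)%N)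
    (le_kl : (#|components G| <= #|components H|)%N) :
  [/\ condA G H \/ condB G H \/ condC G H -> q R (join G H) <> 2%N,
      q R (join G H) <> 2%N <->
        ~ (exists2 A : 'M[R]_(m + n),
             symmat (join G H) A & A *m A^T = 1%:M)
    & complete_components G -> complete_components H ->
        (~ (condA G H \/ condB G H \/ condC G H) -> q R (join G H) = 2%N) /\
        (condA G H \/ condB G H \/ condC G H -> q R (join G H) = 3%N)].
Proof.
have q_gt1 : (1 < q R (join G H))%N.
  by have [A AJ <-] := q_attained R (join G H); apply: num_eigenvalues_gt1 AJ.
have q2P : q R (join G H) = 2%N <->
    exists2 A : 'M[R]_(m + n), symmat (join G H) A & A *m A^T = 1%:M.
  split=> [q2|[A AJ AA]].
    have [A AJ] := q_attained R (join G H); rewrite q2.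
    exact: two_eigenvalues_orthogonal.
  apply/eqP; rewrite eqn_leq q_gt1 andbT; apply: leq_trans (q_le AJ) _.
  by apply: orthogonal_num_eigenvalues => //; case: AJ.
have cond_q : condA G H \/ condB G H \/ condC G H -> q R (join G H) <> 2%N.
  by move=> C /q2P; apply: cond_no_orthogonal.
split=> //; first by rewrite q2P.
move=> cG cH; split=> [N|C]; first exact/q2P/complete_orthogonal.
have [A AJ A3] := three_eigenvalues R m_gt0 n_gt0 cG cH.
apply/eqP; rewrite eqn_leq (leq_trans (q_le AJ)) //.
by rewrite ltn_neqAle q_gt1 andbT eq_sym; apply/eqP/cond_q.
Qed.
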